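(* Let $\boldsymbol{R}=(R_1,\ldots,R_m)$ be a system of $m\ge2$ rational functions in $\mathbb{Q}(X_1,\ldots,X_m)$ of degree at most $d\ge2$ and height at most $h$. Let $P_1,\ldots,P_s\in\mathbb{Z}[X_1,\ldots,X_m]$ have degree at most $D$ and height at most $H$, and let $V\subset\mathbb{A}^m_{\mathbb{Q}}$ be the variety they define. Assume the iterations of $\boldsymbol{R}$ generically escape $V$. Then there is a constant $c>0$ depending only on $(d,D,h,H,m,s)$ such that, for every real $\varepsilon>0$ and every $N\in\mathbb{N}$ with $$N\ge\exp(c/\varepsilon),$$ there exists $\mathfrak{B}\in\mathbb{N}$ with $\log\mathfrak{B}\le\exp(c/\varepsilon)$ such that, for every prime $p$ not dividing $\mathfrak{B}$ and every $\boldsymbol{w}\in\overline{\mathbb{F}}_p^{\,m}$ with $T(\boldsymbol{w})\ge N$, $$\frac{\#\mathfrak{V}_{\boldsymbol{w}}(\boldsymbol{R},V;p,N)}{N}\le\varepsilon.$$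
   Context: Degree and height of a rational function $R=F/G$ (coprime $F,G\in\mathbb{Z}[X]$) are $\max\{\deg F,\deg G\}$ and $\max\{\mathrm{h}(F),\mathrm{h}(G)\}$, with $\mathrm{h}$ of an integer polynomial the log of the maximal absolute value of its coefficients. Iterates: $R_i^{(0)}=X_i$, $R_i^{(n)}=R_i(R_1^{(n-1)},\ldots,R_m^{(n-1)})$; write $R_i^{(n)}=F_{i,n}/G_{i,n}$ with coprime integer polynomials. The iterations of $\boldsymbol{R}$ generically escape $V$ if for every $k\ge1$ the $k$-th iterate $\boldsymbol{R}^{(k)}$ is well defined and $\{\boldsymbol{w}\in\mathbb{C}^m:(\boldsymbol{w},\boldsymbol{R}^{(k)}(\boldsymbol{w}))\in V(\mathbb{C})\times V(\mathbb{C})\}$ is finite. For a prime $p$, $\boldsymbol{R}_p^{(n)}$ and $V_p$ denote the reductions modulo $p$ of $\boldsymbol{R}^{(n)}$ (reducing $F_{i,n},G_{i,n}$) and of $V$ (reducing $P_1,\ldots,P_s$). For $\boldsymbol{w}\in\overline{\mathbb{F}}_p^{\,m}$, with $G_{i,j}\not\equiv0\pmod p$ for $j<N$, $\mathfrak{V}_{\boldsymbol{w}}(\boldsymbol{R},V;p,N)$ is the set of $n\in\{0,\ldots,N-1\}$ such that $\boldsymbol{R}_p^{(n)}(\boldsymbol{w})$ is defined and lies in $V_p(\overline{\mathbb{F}}_p)$. The orbit of $\boldsymbol{w}$ under the reduced system is $\boldsymbol{w}_0=\boldsymbol{w}$, $\boldsymbol{w}_n=\boldsymbol{R}_p(\boldsymbol{w}_{n-1})$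 (terminating at a pole), and $T(\boldsymbol{w})\in\mathbb{N}\cup\{\infty\}$ is the number of distinct points $\boldsymbol{w}_n$, $n\ge1$, in it. *)

(* Defs.v *)
From HB Require Import structures.
From mathcomp Require Import all_boot all_order all_algebra all_field.
From mathcomp Require Import complex.
From mathcomp Require Import boolp classical_sets cardinality reals.
From mathcomp Require Import constructive_ereal sequences exp counting_measure.
(* The notations of mpoly clash with those of mathcomp-analysis. *)
From mathcomp Require Import -(notations) mpoly.

Set Implicit Arguments.
Unset Strict Implicit.
Unset Printing Implicit Defensive.

Import Order.TTheory GRing.Theory Num.Theory.

Local Open Scope ring_scope.

(* Z[X_1, ..., X_m] and Q(X_1, ..., X_m) *)
Notation intpoly m := (mpoly m int).
Notation ratfun m := {fraction mpoly m rat}.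

Section IntegerPolynomials.

Variable m : nat.
Implicit Types F G : intpoly m.

(* Total degree; 0 for the zero polynomial. *)
Definition pdeg F : nat := (mmeasure (@mdeg m) F).-1.

Definition maxcoef F : nat := \max_(a <- msupp F) `|mcoeff a F|%N.

(* ln 0 = 0, so the zero polynomial has height 0. *)
Definition pheight (R : realType) F : R := ln (maxcoef F)%:R.

(* The units of Z[X_1, ..., X_m] are 1 and -1: a common integer factor of the
   coefficients of F and G also counts as a common divisor. *)
Definition coprime_poly F G : Prop :=
  forall D A B : intpoly m, F = D * A -> G = D * B -> D \is a GRing.unit.

(* The value of F at a point with coordinates in K. If K has characteristic p,
   this is the value of the reduction of F modulo p. *)
Definition zeval (K : comNzRingType) F (v : 'I_m -> K) : K :=
  meval v (map_mpoly (intr : int -> K) F).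

Definition zfrac F : ratfun m :=
  FracField.tofrac (map_mpoly (intr : int -> rat) F).

Definition lowest_terms (f : ratfun m) (FG : intpoly m * intpoly m) : Prop :=
  [/\ FG.2 != 0, coprime_poly FG.1 FG.2 & f = zfrac FG.1 / zfrac FG.2].

End IntegerPolynomials.

Section LowestTerms.

Variable m : nat.
Implicit Types F G : intpoly m.

Lemma zfracM F G : zfrac (F * G) = zfrac F * zfrac G.
Proof. by rewrite /zfrac !rmorphM. Qed.

Lemma zfrac_eq0 F : (zfrac F == 0) = (F == 0).
Proof.
rewrite /zfrac tofrac_eq0; apply/eqP/eqP => [F0|->]; last exact: rmorph0.
apply/mpolyP => a; move/(congr1 (mcoeff a)): F0.
by rewrite mcoeff_map_mpoly !mcoeff0 => /eqP; rewrite intr_eq0 => /eqP.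
Qed.

Lemma clear_denominators (p : mpoly m rat) :
  exists2 n : int, n != 0 &
    exists F, n%:~R *: p = map_mpoly (intr : int -> rat) F.
Proof.
elim/mpolyind: p => [|c a p _ _ [n n0 [F eqF]]].
  by exists 1 => //; exists 0; rewrite scaler0 rmorph0.
exists (denq c * n); first by rewrite mulf_neq0 ?denq_neq0.
exists ((n * numq c) *: mpolyX int a + denq c *: F).
rewrite scalerDr rmorphD /= !map_mpolyZ /= -eqF map_mpolyX !scalerA.
congr (_ *: _ + _ *: _); last by rewrite intrM.
by rewrite !intrM numqE [RHS]mulrCA [LHS]mulrC [(denq c)%:~R * _]mulrC.
Qed.

Lemma fraction_quot (R : idomainType) (f : {fraction R}) :
  exists x y : R, y != 0 /\ f = FracField.tofrac x / FracField.tofrac y.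
Proof.
elim/quotW: f => u; exists (frac u).1, (frac u).2; split; first exact: denom_ratioP.
have d0 : FracField.tofrac (frac u).2 != 0 by rewrite tofrac_eq0 denom_ratioP.
apply: (mulIf d0); rewrite mulfVK //; unlock FracField.tofrac.
rewrite -[LHS]FracField.pi_mul; apply/eqmodP.
rewrite /= FracField.equivfE /FracField.mulf /=.
by rewrite !numden_Ratio ?oner_neq0 ?mulr1 ?denom_ratioP // mulrC.
Qed.

Lemma ratfun_quot (f : ratfun m) :
  exists2 FG : intpoly m * intpoly m, FG.2 != 0 & f = zfrac FG.1 / zfrac FG.2.
Proof.
have [x [y [y0 ->]]] := fraction_quot f.
have [a a0 [F eF]] := clear_denominators x.
have [b b0 [G eG]] := clear_denominators y.
have scal (c : int) (z : mpoly m rat) K :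
    c%:~R *: z = map_mpoly (intr : int -> rat) K ->
    zfrac (c%:~R : intpoly m) * FracField.tofrac z = zfrac K.
  by move=> e; rewrite /zfrac -e -tofracM rmorph_int mulrzl scaler_int.
have nz (c : int) : c != 0 -> zfrac (c%:~R : intpoly m) != 0.
  move=> nzc; rewrite zfrac_eq0; apply: contra nzc => /eqP c0.
  have /eqP := congr1 (mcoeff (@mnm0 m)) c0.
  by rewrite -(rmorph_int (mpolyC m (R := int))) mcoeffC eqxx mulr1 mcoeff0 intz.
exists (b%:~R * F, a%:~R * G) => /=.
  rewrite -zfrac_eq0 zfracM -(scal _ _ _ eG).
  by rewrite !mulf_neq0 ?nz ?tofrac_eq0.
rewrite !zfracM -(scal _ _ _ eG) -(scal _ _ _ eF).
rewrite !mulrA [in RHS](mulrC (zfrac _) (zfrac _)) -mulf_div.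
by rewrite divff ?mul1r // mulf_neq0 ?nz.
Qed.

Lemma lowest_terms_exists (f : ratfun m) : exists FG, lowest_terms f FG.
Proof.
have [FG] := ratfun_quot f.
pose mu (G : intpoly m) := (mmeasure (@mdeg m) G + `|mleadc G|)%N.
have [k] := ubnP (mu FG.2); elim: k FG => // k IHk [F G] /= ltk G0 eqf.
have [cFG|] := pselect (coprime_poly F G); first by exists (F, G).
move=> /existsNP[D] /existsNP[A] /existsNP[B] /not_implyP[eF].
move=> /not_implyP[eG /negP Dnu].
have /andP[D0 B0] : (D != 0) && (B != 0) by rewrite -negb_or -mulf_eq0 -eG.
apply: (IHk (A, B)) => //=; last first.
  by rewrite eqf eF eG !zfracM -mulf_div divff ?mul1r // zfrac_eq0.
suff ltmu : (mu B < mu G)%N by apply: leq_trans ltmu _; rewrite -ltnS.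
rewrite /mu eG msizeM // mleadM // mleadcM abszM.
have sD : (0 < mmeasure (@mdeg m) D)%N by rewrite lt0n msize_poly_eq0.
have lD : (0 < `|mleadc D|)%N by rewrite absz_gt0 mleadc_eq0.
have lB : (0 < `|mleadc B|)%N by rewrite absz_gt0 mleadc_eq0.
have [sD1|] := leqP (mmeasure (@mdeg m) D) 1; last first.
  move=> sD2.
  have le1 : (`|mleadc B| <= `|mleadc D| * `|mleadc B|)%N by rewrite leq_pmull.
  rewrite -addSn leq_add // -ltnS prednK ?addn_gt0 ?sD //.
  by rewrite -addn2 addnC leq_add2r.
have eD := msize1_polyC sD1.
have -> : mmeasure (@mdeg m) D = 1%N by apply/eqP; rewrite eqn_leq sD1.
rewrite add1n /= ltn_add2l ltn_Pmull // ltn_neqAle lD andbT eq_sym.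
apply: contra Dnu => lD1; rewrite eD mleadcC in lD1.
set u : int := mcoeff _ _ in lD1 *.
have uu : u * u = 1 by rewrite -expr2 -real_normK ?num_real // -abszE (eqP lD1) expr1n.
by apply/unitrP; exists (mpolyC m u); rewrite eD -mpolyCM uu.
Qed.

End LowestTerms.

Section RationalFunctions.

Variable m : nat.
Implicit Types f : ratfun m.

(* The numerator and denominator in lowest terms are unique up to a common
   sign, on which nothing below depends. *)
Definition num f : intpoly m := (projT1 (cid (lowest_terms_exists f))).1.
Definition den f : intpoly m := (projT1 (cid (lowest_terms_exists f))).2.

Definition rdeg f : nat := maxn (pdeg (num f)) (pdeg (den f)).

Definition rheight (R : realType) f : R :=
  Num.max (pheight R (num f)) (pheight R (den f)).

Definition rX (i : 'I_m) : ratfun m := FracField.tofrac (mpolyX rat (mnm1 i)).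

End RationalFunctions.

Section Systems.

Variable m : nat.
Implicit Types S : 'I_m -> ratfun m.

Fixpoint iterate S (n : nat) : 'I_m -> ratfun m :=
  if n is n'.+1 then
    fun i => zeval (num (S i)) (iterate S n') / zeval (den (S i)) (iterate S n')
  else @rX m.

(* No denominator vanishes identically in the substitutions that lead to the
   n-th iterate. *)
Definition iterate_defined S (n : nat) : Prop :=
  forall k, (k < n)%N -> forall i, zeval (den (S i)) (iterate S k) != 0.

Section Points.

Variable K : fieldType.
Implicit Types w : {ffun 'I_m -> K}.

Definition on_variety s (P : 'I_s -> intpoly m) w : bool :=
  [forall j, zeval (P j) w == 0].

(* In characteristic p these two evaluate the reduction modulo p of S,
   obtained by reducing the numerators and denominators in lowest terms over
   Z; no factor common to the two reductions is cancelled. *)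
Definition defined_at S w : bool := [forall i, zeval (den (S i)) w != 0].
Definition value S w : {ffun 'I_m -> K} :=
  [ffun i => zeval (num (S i)) w / zeval (den (S i)) w].

Definition step S w : option {ffun 'I_m -> K} :=
  if defined_at S w then Some (value S w) else None.

Definition orbit_point S w (n : nat) : option {ffun 'I_m -> K} :=
  iter n (obind (step S)) (Some w).

Definition orbit_size (R : realType) S w : \bar R :=
  counting [set v | exists2 n, (1 <= n)%N & orbit_point S w n = Some v]%classic.

Definition visits S s (P : 'I_s -> intpoly m) w (N : nat) : {set 'I_N} :=
  [set n : 'I_N | defined_at (iterate S n) w &&
                  on_variety P (value (iterate S n) w)]%SET.

End Points.

Definition generically_escape (R : realType) S s (P : 'I_s -> intpoly m) :
    Prop :=
  forall k, (1 <= k)%N ->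
    iterate_defined S k /\
    finite_set [set w : {ffun 'I_m -> R[i]} |
      [/\ on_variety P w, defined_at (iterate S k) w
        & on_variety P (value (iterate S k) w)]]%classic.

End Systems.

(* An algebraic closure of the field with p elements (p prime). *)
Definition Fpbar (p : nat) : closedFieldType :=
  tag (countable_algebraic_closure 'F_p).

(* Main.v *)
Require Import Defs.
From HB Require Import structures.
From mathcomp Require Import all_boot all_order all_algebra all_fingroup
  all_field.
From mathcomp Require Import ring lra zify.
From mathcomp Require Import complex finmap.
From mathcomp Require Import boolp classical_sets cardinality.
From mathcomp Require Import reals constructive_ereal sequences exp.
From mathcomp Require Import counting_measure.
From mathcomp Require Import -(notations) mpoly.

(** If more than [eps * N] of the times [n < N] are visits, then for some
    [k <= 2 / eps] many visits [n] are followed by a visit at time [n + k].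
    Along a long orbit the corresponding points [w_n] are distinct, and they
    all satisfy the polynomial system "w and R^(k)(w) lie on V", whose
    complex solutions are finite in number.  It therefore suffices to bound
    the number of solutions modulo [p] of an integral system with finitely
    many complex solutions, for all [p] outside the divisors of an integer
    [B], with both the number of solutions and [log B] polynomial in the
    size of the system (which is exponential in [k]).

    This is done by eliminating one variable at a time.  A Nagata change of
    variables makes the leading coefficient of one equation [p] a nonzero
    integer; the resultants of [p] with [p * X^n + \sum_i c^i f_i], for
    enough integers [c], then cut out exactly the projection of the solution
    set over the complex numbers, and contain the projection modulo every
    prime not dividing that integer.  Solution sets thus stay finite, and
    each fibre has at most [deg p] points.  Norms of polynomials in [m]
    variables grow polynomially at each step.

    The finiteness hypothesis concerns the iterates in lowest terms, whereas
    the system is written with a common denominator built recursively; the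
    two are compared using unique factorisation in Z[X_1, ..., X_m]. *)

Set Implicit Arguments.
Unset Strict Implicit.
Unset Printing Implicit Defensive.

Import Order.TTheory GRing.Theory Num.Theory.

Local Open Scope ring_scope.

(** * Iterated integer polynomial rings and their norm *)

(** Nesting univariate rings singles out the last variable, in which leading coefficients,
    resultants and pseudo-divisions are taken. *)
Fixpoint ipoly (m : nat) : idomainType :=
  if m is m'.+1 then {poly (ipoly m')} : idomainType else int : idomainType.

Lemma poly_rmorph_ext (A B : nzRingType) (f g : {rmorphism {poly A} -> B}) :
  (forall c, f c%:P = g c%:P) -> f 'X = g 'X -> f =1 g.
Proof.
move=> fgC fgX; elim/poly_ind => [|p c IHp]; first by rewrite !rmorph0.
by rewrite !rmorphD !rmorphM /= IHp fgC fgX.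
Qed.

Lemma int_rmorph_ext (B : nzRingType) (f g : {rmorphism int -> B}) : f =1 g.
Proof. by move=> a; rewrite -(intz a) !rmorph_int. Qed.

Fixpoint ieval (K : comNzRingType) (x : nat -> K) (m : nat) :
    {rmorphism ipoly m -> K} :=
  if m is m'.+1 return {rmorphism ipoly m -> K} then
    (@horner_eval K (x m') \o map_poly (ieval x m') : {rmorphism {poly ipoly
      m'} -> K})
  else (intr : {rmorphism int -> K}).

Fixpoint var (m : nat) (i : nat) : ipoly m :=
  if m is m'.+1 return ipoly m then
    if i == m' then ('X : {poly ipoly m'}) else (var m' i)%:P
  else (0 : int).

Lemma ievalS (K : comNzRingType) (x : nat -> K) m (f : ipoly m.+1) :
  ieval x m.+1 f = (map_poly (ieval x m) f).[x m].
Proof. by []. Qed.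

Lemma ievalC (K : comNzRingType) (x : nat -> K) m (f : ipoly m) :
  ieval x m.+1 (f%:P) = ieval x m f.
Proof. by rewrite ievalS map_polyC hornerC. Qed.

Lemma ieval_var (K : comNzRingType) (x : nat -> K) m i :
  (i < m)%N -> ieval x m (var m i) = x i.
Proof.
elim: m => // m IHm lti; rewrite /=; case: eqP => [->|/eqP ne] /=.
  by rewrite map_polyX /horner_eval hornerX.
rewrite map_polyC /horner_eval hornerC; apply: IHm.
by rewrite ltn_neqAle ne -ltnS.
Qed.

Lemma ipoly_rmorph_ext m (B : comNzRingType) (f g : {rmorphism ipoly m -> B}) :
  (forall i, (i < m)%N -> f (var m i) = g (var m i)) -> f =1 g.
Proof.
elim: m f g => [|m IHm] f g fg; first exact: int_rmorph_ext.
apply: (@poly_rmorph_ext (ipoly m) B f g) => [c|]; last first.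
  by have := fg m (ltnSn m); rewrite /= eqxx.
have := IHm (f \o (polyC : {rmorphism ipoly m -> {poly ipoly m}}))
            (g \o (polyC : {rmorphism ipoly m -> {poly ipoly m}})).
apply=> i lti /=; have := fg i (ltnW lti); rewrite /=.
by rewrite ltn_eqF.
Qed.

Lemma eq_ieval (K : comNzRingType) (x y : nat -> K) m :
  (forall i, (i < m)%N -> x i = y i) -> ieval x m =1 ieval y m.
Proof.
by move=> xy; apply: ipoly_rmorph_ext => i lti; rewrite !ieval_var ?xy.
Qed.

(** This is the value at [(2, ..., 2)] of the polynomial with the absolute values of the
    coefficients. The weight [2 ^ degree] keeps it submultiplicative and makes it see the degree. *)
Fixpoint inorm (m : nat) : ipoly m -> nat :=
  if m is m'.+1 return ipoly m -> nat then
    fun f : {poly ipoly m'} => (\sum_(i < size f) inorm f`_i * 2 ^ i)%N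
  else fun a : int => `|a|%N.
Arguments inorm : clear implicits, simpl never.

Lemma inorm_absz (a : int) : inorm 0 a = `|a|%N. Proof. by []. Qed.

Lemma inormS m (f : {poly ipoly m}) :
  inorm m.+1 f = (\sum_(i < size f) inorm m f`_i * 2 ^ i)%N.
Proof. by []. Qed.

Lemma inorm0 m : inorm m 0 = 0%N.
Proof. by case: m => // m; rewrite inormS size_poly0 big_ord0. Qed.

Lemma inormE m (f : {poly ipoly m}) n : (size f <= n)%N ->
  inorm m.+1 f = (\sum_(i < n) inorm m f`_i * 2 ^ i)%N.
Proof.
move=> len; rewrite inormS (big_ord_widen n (fun i => inorm m f`_i * 2 ^ i)%N
  len) /=.
rewrite [RHS](bigID (fun i : 'I_n => (i < size f)%N)) /=.
rewrite [X in (_ + X)%N]big1 ?addn0 // => i.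
by rewrite -leqNgt => /(nth_default 0) ->; rewrite inorm0 mul0n.
Qed.

Lemma inormC m (c : ipoly m) : inorm m.+1 c%:P = inorm m c.
Proof. by rewrite (@inormE _ _ 1) ?size_polyC_leq1 // big_ord1 coefC eqxx
  muln1. Qed.

Lemma inormN m (f : ipoly m) : inorm m (- f) = inorm m f.
Proof.
elim: m f => [|m IHm] f; first exact: abszN.
by rewrite !inormS size_polyN; apply: eq_bigr => i _; rewrite coefN IHm.
Qed.

Lemma inormD m (f g : ipoly m) : (inorm m (f + g) <= inorm m f + inorm m g)%N.
Proof.
elim: m f g => [|m IHm] f g; first by change (absz ((f : int) + (g : int))%R <=
  absz f + absz g)%N; lia.
have lf := leq_maxl (size (f : {poly _})) (size (g : {poly _})).
have lg := leq_maxr (size (f : {poly _})) (size (g : {poly _})).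
rewrite !(@inormE _ _ (maxn (size (f : {poly _})) (size (g : {poly _})))) //;
  last exact: size_polyD.
rewrite -big_split leq_sum //= => i _.
by rewrite coefD -mulnDl leq_mul2r IHm orbT.
Qed.

Lemma inorm_sum m (I : Type) (r : seq I) (P : pred I) (F : I -> ipoly m) :
  (inorm m (\sum_(i <- r | P i) F i) <= \sum_(i <- r | P i) inorm m (F i))%N.
Proof.
elim/big_rec2: _ => [|i a b _ le]; first by rewrite inorm0.
by apply: leq_trans (inormD _ _) _; rewrite leq_add2l.
Qed.

Lemma inormMXn m (f : {poly ipoly m}) n :
  inorm m.+1 (f * 'X^n) = (inorm m.+1 f * 2 ^ n)%N.
Proof.
rewrite (@inormE _ _ (n + size f)); last first.
  by rewrite (leq_trans (size_polyMleq _ _)) // size_polyXn addnS addnC.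
rewrite big_split_ord /= big1 ?add0n; last first.
  by move=> i _; rewrite coefMXn ltn_ord inorm0.
rewrite big_distrl; apply: eq_bigr => i _ /=.
by rewrite coefMXn ltnNge leq_addr /= addKn addnC expnD mulnA.
Qed.

(** Expand [f] in powers of the last variable: multiplying by ['X^i] multiplies the norm by exactly
    [2 ^ i], and scaling by a coefficient is the case of fewer variables. *)
Lemma inormM m (f g : ipoly m) : (inorm m (f * g) <= inorm m f * inorm m g)%N.
Proof.
elim: m f g => [|m IHm] f g; first by rewrite -[X in (X <= _)%N]/(absz ((f :
  int) * (g : int))) abszM.
have inormZ (c : ipoly m) (h : {poly ipoly m}) :
    (inorm m.+1 (c *: h) <= inorm m c * inorm m.+1 h)%N.
  rewrite (@inormE _ _ (size h)) ?size_scale_leq //.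
  rewrite (@inormE _ h (size h)) // big_distrr leq_sum //= => i _.
  by rewrite coefZ mulnA leq_mul2r IHm orbT.
rewrite -[in X in (X <= _)%N](coefK f) poly_def mulr_suml.
apply: leq_trans (inorm_sum _ _ _) _; rewrite big_distrl leq_sum //= => i _.
rewrite -scalerAl mulrC -mulnA (leq_trans (inormZ _ _)) //.
by rewrite inormMXn [(2 ^ i * _)%N]mulnC.
Qed.

Lemma inorm_int m (a : int) : inorm m a%:~R = `|a|%N.
Proof.
elim: m => [|m IHm]; first by rewrite -[X in absz X]intz.
by rewrite -(rmorph_int (polyC : {rmorphism _ -> {poly ipoly m}})) inormC.
Qed.

Lemma inormX m (f : ipoly m) n : (inorm m (f ^+ n) <= inorm m f ^ n)%N.
Proof.
elim: n => [|n IHn]; first by rewrite expr0 -[1]/(1%:~R) inorm_int.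
by rewrite exprS expnS (leq_trans (inormM _ _)) // leq_mul2l IHn orbT.
Qed.

Lemma inorm_prod m (I : Type) (r : seq I) (P : pred I) (F : I -> ipoly m) :
  (inorm m (\prod_(i <- r | P i) F i) <= \prod_(i <- r | P i) inorm m (F i))%N.
Proof.
elim/big_rec2: _ => [|i a b _ le]; first by rewrite -[1]/(1%:~R) inorm_int.
by apply: leq_trans (inormM _ _) _; rewrite leq_mul2l le orbT.
Qed.

Lemma inorm_coef m (f : {poly ipoly m}) i : (inorm m f`_i <= inorm m.+1 f)%N.
Proof.
have [lti|lei] := ltnP i (size f); last by rewrite nth_default ?inorm0.
rewrite inormS (bigD1 (Ordinal lti)) //= (leq_trans _ (leq_addr _ _)) //.
by rewrite leq_pmulr ?expn_gt0.
Qed.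

Lemma inorm_gt0 m (f : ipoly m) : f != 0 -> (0 < inorm m f)%N.
Proof.
elim: m f => [|m IHm] f f0; first by rewrite inorm_absz absz_gt0.
apply: leq_trans (inorm_coef (f : {poly _}) (size (f : {poly ipoly m})).-1).
by apply: IHm; rewrite -/(lead_coef _) lead_coef_eq0.
Qed.

(* As the coefficients are integers, this norm bounds the degree as well as
   the height. *)
Lemma size_inorm m (f : {poly ipoly m}) L :
  (inorm m.+1 f <= 2 ^ L)%N -> (size f <= L.+1)%N.
Proof.
have [->|f0] := eqVneq f 0; first by rewrite size_poly0.
move=> le; rewrite -[size f]prednK ?ltnS ?size_poly_gt0 //.
rewrite -(@leq_exp2l 2) //; apply: leq_trans le.
have lt : ((size f).-1 < size f)%N by rewrite prednK ?size_poly_gt0.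
rewrite inormS (bigD1 (Ordinal lt)) //= (leq_trans _ (leq_addr _ _)) //.
by rewrite leq_pmull // inorm_gt0 // -/(lead_coef _) lead_coef_eq0.
Qed.

Lemma leq_sum_exp (I : Type) (r : seq I) (F : I -> nat) b : (0 < b)%N ->
  (\sum_(i <- r) F i ^ b <= (\sum_(i <- r) F i) ^ b)%N.
Proof.
move=> b0; elim: r => [|i r IHr]; first by rewrite !big_nil exp0n.
rewrite !big_cons; apply: leq_trans (_ : F i ^ b + (\sum_(j <- r) F j) ^ b <=
  _)%N.
  by rewrite leq_add2l.
move: (F i) (\sum_(j <- r) F j)%N => u v.
case: b b0 {IHr} => // b _; elim: b => [|b IHb]; first by rewrite !expn1.
rewrite (expnS (u + v)); apply: leq_trans (leq_mul (leqnn _) IHb).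
by rewrite !(expnS _ b.+1); nia.
Qed.

(** A substitution turns the weight [2 ^ i] into at most [(2 ^ i) ^ b], and an integer coefficient
    is at most its own [b]-th power. Superadditivity of the [b]-th power then gathers the
    monomials. *)
Lemma inorm_morph m m' (g : {rmorphism ipoly m -> ipoly m'}) b :
  (0 < b)%N -> (forall i, (i < m)%N -> inorm m' (g (var m i)) <= 2 ^ b)%N ->
  forall f, (inorm m' (g f) <= inorm m f ^ b)%N.
Proof.
move=> b0; elim: m g => [|m IHm] g gvar f.
  rewrite -(intz f) rmorph_int !inorm_int.
  by case: `|f|%N => // k; rewrite -[X in (X <= _)%N]expn1 leq_pexp2l.
pose gC := g \o (polyC : {rmorphism ipoly m -> {poly ipoly m}}).
have leC c : (inorm m' (g c%:P) <= inorm m c ^ b)%N.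
  apply: (IHm gC) => i lti /=.
  by have := gvar i (ltnW lti); rewrite /= ltn_eqF.
have leX : (inorm m' (g 'X) <= 2 ^ b)%N.
  by have := gvar m (ltnSn m); rewrite /= eqxx.
rewrite -[in X in (X <= _)%N](coefK f) poly_def rmorph_sum.
apply: leq_trans (inorm_sum _ _ _) _.
apply: leq_trans (leq_sum_exp _ _ b0); apply: leq_sum => i _.
rewrite -mul_polyC rmorphM rmorphXn (leq_trans (inormM _ _)) // expnMn.
rewrite leq_mul // (leq_trans (inormX _ _)) // -expnM mulnC expnM.
by case: (nat_of_ord i) => // k; rewrite leq_exp2r.
Qed.

(** * Nagata change of variables *)

Lemma size_sum_dominant (A : nzRingType) n (F : 'I_n -> {poly A}) i0 :
  F i0 != 0 -> (forall i, i != i0 -> (size (F i) < size (F i0))%N) ->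
  size (\sum_i F i) = size (F i0) /\ lead_coef (\sum_i F i) = lead_coef (F i0).
Proof.
move=> F0 dom; rewrite (bigD1 i0) //=.
suff lt : (size (\sum_(i | i != i0) F i)%R < size (F i0))%N.
  by rewrite size_polyDl // lead_coefDl.
rewrite -[X in (_ < X)%N]prednK ?size_poly_gt0 // ltnS.
apply: leq_trans (size_sum _ _ _) _; apply/bigmax_leqP => i /dom.
by move=> lt; rewrite -ltnS prednK // size_poly_gt0.
Qed.

Lemma horner_map_sum (A B : nzRingType) (g : {rmorphism A -> B}) (f : {poly A})
  x :
  (map_poly g f).[x] = \sum_(i < size f) g f`_i * x ^+ i.
Proof.
rewrite (@horner_coef_wide _ (size f)); last exact: size_poly.
by apply: eq_bigr => i _; rewrite coef_map.
Qed.

Section Nagata.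

Variable L : nat.

(** The substitution [X_i -> X_i + Y^((L+1)^(i+1))], where [Y] is the outer variable of
    [{poly ipoly m}]. *)
Fixpoint nagata (m : nat) : {rmorphism ipoly m -> {poly ipoly m}} :=
  if m is m'.+1 return {rmorphism ipoly m -> {poly ipoly m}} then
    (horner_eval (('X : ipoly m'.+1)%:P + 'X^(L.+1 ^ m'.+1)) \o
     map_poly (map_poly (polyC : ipoly m' -> ipoly m'.+1) \o nagata m') :
       {rmorphism {poly ipoly m'} -> {poly {poly ipoly m'}}})
  else (polyC : {rmorphism int -> {poly int}}).

Lemma nagataS m (f : {poly ipoly m}) : nagata m.+1 f =
  (map_poly (map_poly (polyC : ipoly m -> ipoly m.+1) \o nagata m) f).[
    ('X : ipoly m.+1)%:P + 'X^(L.+1 ^ m.+1)].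
Proof. by []. Qed.

Lemma nagata_var m i : (i < m)%N ->
  nagata m (var m i) = (var m i)%:P + 'X^(L.+1 ^ i.+1).
Proof.
elim: m => // m IHm lti; rewrite nagataS [var _ _]/=; case: eqP => [->|/eqP ne].
  by rewrite map_polyX hornerX.
rewrite map_polyC hornerC /= IHm; last by rewrite ltn_neqAle ne -ltnS.
by rewrite rmorphD /= map_polyC map_polyXn.
Qed.

(** All exponents are at most [L], so the exponents of a monomial are the base [L + 1] digits of its
    degree in [Y]: distinct monomials get distinct degrees and the largest one cannot cancel. The
    digit of weight 1 is left empty, whence [L.+1 %| d]; [shear_lead] puts the last variable
    there. *)
Lemma nagata_lead m (f : ipoly m) : f != 0 -> (inorm m f <= 2 ^ L)%N ->
  exists2 a : int, a != 0 & exists d, [/\ (d < L.+1 ^ m.+1)%N, (L.+1 %| d)%N,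
    size (nagata m f) = d.+1 & lead_coef (nagata m f) = a%:~R].
Proof.
elim: m f => [|m IHm] f f0 fL.
  exists f => //; exists 0%N; rewrite size_polyC f0 lead_coefC; split=> //.
  by rewrite -[LHS]intz.
pose N := (L.+1 ^ m.+1)%N.
pose u : {poly ipoly m.+1} := ('X : ipoly m.+1)%:P + 'X^N.
have N0 : (0 < N)%N by rewrite expn_gt0.
have size_u : size u = N.+1.
  by rewrite /u addrC size_polyDl size_polyXn // ltnS (leq_trans
    (size_polyC_leq1 _)).
have lead_u : lead_coef u = 1.
  by rewrite /u addrC lead_coefDl ?lead_coefXn // size_polyXn ltnS
    (leq_trans (size_polyC_leq1 _)).
pose lift := map_poly (polyC : {rmorphism ipoly m -> ipoly m.+1}).
have size_lift h : size (lift h) = size h.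
  by rewrite /lift size_map_inj_poly ?polyC0 //; apply: polyC_inj.
have lead_lift h : lead_coef (lift h) = (lead_coef h)%:P.
  by rewrite /lift lead_coef_map_inj //; apply: polyC_inj.
pose F j := lift (nagata m (f : {poly ipoly m})`_j) * u ^+ j.
have eqf : nagata m.+1 f = \sum_(j < size (f : {poly ipoly m})) F j.
  by rewrite nagataS (horner_map_sum (lift \o nagata m : {rmorphism _ -> _})).
have size_F j d : size (nagata m (f : {poly ipoly m})`_j) = d.+1 ->
    size (F j) = (d + j * N).+1.
  move=> sd; have lift0 : lift (nagata m (f : {poly ipoly m})`_j) != 0.
    by rewrite -size_poly_gt0 size_lift sd.
  have u0 : u ^+ j != 0 by rewrite expf_neq0 // -size_poly_gt0 size_u.
  rewrite size_mul // size_lift sd /= -[size (u ^+ j)]prednK ?size_poly_gt0 //.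
  by rewrite size_exp size_u addnS mulnC.
have coefL j := leq_trans (inorm_coef (f : {poly ipoly m}) j) fL.
have sf : (0 < size (f : {poly ipoly m}))%N by rewrite size_poly_gt0.
have ltJ : ((size (f : {poly ipoly m})).-1 < size (f : {poly ipoly m}))%N.
  by rewrite prednK.
pose J := Ordinal ltJ.
have eJ : J.+1 = size (f : {poly ipoly m}) by exact: prednK.
have fJ0 : (f : {poly ipoly m})`_J != 0 by rewrite -/(lead_coef _)
  lead_coef_eq0.
have [a a0 [d [ltd Ldvd sd ld]]] := IHm _ fJ0 (coefL J).
have sJ := size_F _ _ sd.
(* The top power [J] of the last variable dominates: for [i < J] the degree is
   [e + i * N < (i + 1) * N <= J * N], since [e < N]. *)
have [||sS lS] := @size_sum_dominant _ _ (fun j => F j) J.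
- by rewrite -size_poly_gt0 sJ.
- move=> i neqi; have [fi0|fi0] := eqVneq (f : {poly ipoly m})`_i 0.
    by rewrite /F fi0 rmorph0 /lift rmorph0 mul0r size_poly0 sJ.
  have [_ _ [e [lte _ se _]]] := IHm _ fi0 (coefL i).
  have lti : (i < J)%N.
    have ne : val i != val J by rewrite val_eqE.
    by rewrite ltn_neqAle ne -ltnS eJ ltn_ord.
  rewrite (size_F _ _ se) sJ ltnS; apply: leq_trans (leq_addl _ _).
  by apply: leq_trans (leq_mul lti (leqnn N)); rewrite mulSn ltn_add2r.
exists a => //; exists (d + J * N)%N; split.
- have leJ : (J <= L)%N by rewrite -ltnS eJ; apply: size_inorm.
  rewrite expnS mulSn -/N; apply: leq_trans (_ : N + J * N <= _)%N.
    by rewrite ltn_add2r.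
  by rewrite leq_add2l leq_mul2r leJ orbT.
- by rewrite dvdn_add // dvdn_mull // /N expnS dvdn_mulr.
- by rewrite eqf sS.
rewrite eqf lS lead_coefM lead_lift ld lead_coef_exp lead_u expr1n mulr1.
by rewrite rmorph_int.
Qed.

(** The new variable of [nagata] is identified with the last variable, which itself stays fixed. *)
Definition shear m : {rmorphism ipoly m.+1 -> ipoly m.+1} :=
  (horner_eval 'X \o map_poly (nagata m) : {rmorphism {poly ipoly m} -> {poly
    ipoly m}}).

Lemma shear_var m i : (i <= m)%N -> shear m (var m.+1 i) =
  if (i < m)%N then var m.+1 i + var m.+1 m ^+ (L.+1 ^ i.+1) else var m.+1 i.
Proof.
rewrite leq_eqVlt => /orP[/eqP ->|lti].
  by rewrite ltnn /= eqxx map_polyX /horner_eval hornerX.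
rewrite lti /= eqxx ltn_eqF // map_polyC /horner_eval hornerC /=.
by rewrite nagata_var.
Qed.

Lemma ieval_shear (K : comNzRingType) (x : nat -> K) m (f : ipoly m.+1) :
  ieval x m.+1 (shear m f) =
  ieval (fun i => if (i < m)%N then x i + x m ^+ (L.+1 ^ i.+1) else x i) m.+1 f.
Proof.
move: f; apply: (@ipoly_rmorph_ext m.+1 K (ieval x m.+1 \o shear m)) => i lti.
rewrite ieval_var // -[LHS]/(ieval x m.+1 (shear m (var m.+1 i))) shear_var //.
by case: ifP => _; rewrite ?rmorphD ?rmorphXn !ieval_var.
Qed.

Lemma inorm_var m i : (i < m)%N -> inorm m (var m i) = 2%N.
Proof.
elim: m => // m IHm lti; rewrite /=; case: eqP => [_|/eqP ne].
  by rewrite -['X]mul1r -['X]expr1 inormMXn inormC -[1]/(1%:~R) inorm_int.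
by rewrite inormC IHm // ltn_neqAle ne -ltnS.
Qed.

Lemma inorm_shear m f : (inorm m.+1 f <= 2 ^ L)%N ->
  (inorm m.+1 (shear m f) <= 2 ^ (L * (L.+1 ^ m).+1))%N.
Proof.
move=> fL; rewrite expnM; apply: leq_trans (_ : inorm _ f ^ (L.+1 ^ m).+1 <=
  _)%N.
  apply: inorm_morph => // i lti; rewrite shear_var //; case: ifP => ltim.
    apply: leq_trans (inormD _ _) _;
      rewrite inorm_var // (leq_trans (leq_add (leqnn _) (inormX _ _))) //.
    rewrite inorm_var // [X in (_ <= X)%N]expnS mul2n -addnn leq_add //
      ?leq_pexp2l //.
    by rewrite -[X in (X <= _)%N]expn1 leq_pexp2l // expn_gt0.
  by rewrite inorm_var // -[X in (X <= _)%N]expn1 leq_pexp2l.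
by rewrite leq_exp2r.
Qed.

(** The coefficient of ['X^j] contributes degree [d + j] with [L + 1] dividing [d] and [j <= L]. The
    residue modulo [L + 1] recovers [j], so no two contributions have the same degree and the
    largest one keeps its integer leading coefficient. *)
Lemma shear_lead m (f : {poly ipoly m}) : f != 0 -> (inorm m.+1 f <= 2 ^ L)%N ->
  exists2 a : int, a != 0 & lead_coef (shear m f : {poly ipoly m}) = a%:~R.
Proof.
move=> f0 fL; pose F j := nagata m f`_j * 'X^j.
have -> : (shear m f : {poly ipoly m}) = \sum_(j < size f) F j.
  exact: (horner_map_sum (nagata m)).
have coefL j := leq_trans (inorm_coef f j) fL.
have size_F j d : size (nagata m f`_j) = d.+1 -> size (F j) = (d + j).+1.
  move=> sd; rewrite size_mulXn ?sd ?addnS 1?addnC //.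
  by rewrite -size_poly_gt0 sd.
have lt0 : ((size f).-1 < size f)%N by rewrite prednK ?size_poly_gt0.
have F0 : F (size f).-1 != 0.
  have fJ0 : f`_(size f).-1 != 0 by rewrite -/(lead_coef _) lead_coef_eq0.
  have [_ _ [d [_ _ sd _]]] := nagata_lead fJ0 (coefL _).
  by rewrite -size_poly_gt0 (size_F _ _ sd).
have [J _ maxJ0] := @arg_maxnP _ (Ordinal lt0) predT (fun j => size (F j)) isT.
have maxJ i : (i < size f)%N -> (size (F i) <= size (F J))%N.
  by move=> lti; exact: (maxJ0 (Ordinal lti) isT).
have FJ0 : F J != 0.
  by rewrite -size_poly_gt0 (leq_trans _ (maxJ _ lt0)) // size_poly_gt0.
have fJ0 : f`_J != 0.
  by apply: contraNneq FJ0 => fJ0; rewrite /F fJ0 rmorph0 mul0r.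
have [a a0 [d [_ Ld sd ld]]] := nagata_lead fJ0 (coefL J).
have [//||_ ->] := @size_sum_dominant _ _ (fun j => F j) J.
  move=> i neqi; have [fi0|fi0] := eqVneq f`_i 0.
    by rewrite /F fi0 rmorph0 mul0r size_poly0 size_poly_gt0.
  have [_ _ [e [_ Le se _]]] := nagata_lead fi0 (coefL i).
  rewrite ltn_neqAle maxJ // andbT (size_F _ _ se) (size_F _ _ sd) eqSS.
  apply: contra neqi => /eqP eqsum; apply/eqP/val_inj => /=.
  have := size_inorm fL; move: (ltn_ord i) (ltn_ord J) => lti ltJ lef.
  have := congr1 (modn^~ L.+1) eqsum;
    rewrite /= -modnDml (eqP Le) -[RHS]modnDml (eqP Ld).
  by rewrite !add0n !modn_small ?(leq_trans lti) ?(leq_trans ltJ).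
by exists a => //; rewrite lead_coefM lead_coefXn mulr1.
Qed.

End Nagata.

(** * Elimination by resultants *)

(** When both leading coefficients survive, the Sylvester matrix keeps its dimensions and is mapped
    entrywise. *)
Lemma map_resultant_lead (A B : comNzRingType) (h : {rmorphism A -> B})
    (p q : {poly A}) :
  h (lead_coef p) != 0 -> h (lead_coef q) != 0 ->
  h (resultant p q) = resultant (map_poly h p) (map_poly h q).
Proof.
move=> hp hq; rewrite /resultant /Sylvester_mx !size_map_poly_id0 //.
rewrite -det_map_mx /= map_col_mx; congr (\det (col_mx _ _));
  by apply: map_lin1_mx => v; rewrite map_poly_rV rmorphM /= map_rVpoly.
Qed.

Section Elimination.

Variables (A : idomainType) (p : {poly A}) (fs : seq {poly A}) (n : nat).
Hypotheses (p0 : p != 0) (size_fs : forall f, f \in fs -> (size f <= n)%N).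

(* Adding p * 'X^n keeps the leading coefficient that of p under every
   specialisation where the latter survives, without changing the common
   zeros with p. *)
Definition pencil (c : nat) : {poly A} :=
  p * 'X^n + \sum_(i < size fs) fs`_i *+ c ^ i.

Lemma lead_coef_pencil c : lead_coef (pencil c) = lead_coef p.
Proof.
rewrite /pencil lead_coefDl ?lead_coefM ?lead_coefXn ?mulr1 //.
rewrite size_mulXn //; apply: leq_ltn_trans (_ : n < _)%N; last first.
  by rewrite -[X in (X < _)%N]addn0 ltn_add2l size_poly_gt0.
apply: leq_trans (size_sum _ _ _) _; apply/bigmax_leqP => i _.
by rewrite -scaler_nat (leq_trans (size_scale_leq _ _)) // size_fs ?mem_nth.
Qed.

Section Specialisation.

Variables (K : fieldType) (h : {rmorphism A -> K}).
Hypothesis lead0 : h (lead_coef p) != 0.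

Lemma map_pencil c x : (map_poly h (pencil c)).[x] =
  (map_poly h p).[x] * x ^+ n + \sum_(i < size fs) (map_poly h fs`_i).[x] *+ c
    ^ i.
Proof.
rewrite rmorphD rmorphM /= map_polyXn hornerD hornerM hornerXn rmorph_sum /=.
rewrite horner_sum; congr (_ + _); apply: eq_bigr => i _.
by rewrite rmorphMn hornerMn.
Qed.

Lemma resultant_pencil0 c :
  (h (resultant p (pencil c)) == 0) =
  (1 < size (gcdp (map_poly h p) (map_poly h (pencil c))))%N.
Proof. by rewrite map_resultant_lead ?lead_coef_pencil // resultant_eq0. Qed.

Lemma map_lead_neq0 : map_poly h p != 0.
Proof. by rewrite -lead_coef_eq0 lead_coef_map_eq. Qed.

Lemma common_zero_resultant x :
  (map_poly h p).[x] = 0 -> (forall f, f \in fs -> (map_poly h f).[x] = 0) ->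
  forall c, h (resultant p (pencil c)) = 0.
Proof.
move=> px fsx c; apply/eqP; rewrite resultant_pencil0.
apply: (@root_size_gt1 _ x); first by rewrite gcdp_eq0 negb_and map_lead_neq0.
rewrite root_gcd /root px eqxx map_pencil px mul0r add0r big1 ?eqxx // => i _.
by rewrite fsx ?mul0rn ?mem_nth.
Qed.

End Specialisation.

(** Each [c] provides a root [x] of [p] at which [Q x], the polynomial in [c] with coefficients
    [f_i(x)], vanishes. The product of the [Q x] over all roots thus has more zeros than its degree
    allows, so one [Q x] is zero, and all [f_i] vanish at that [x]. Characteristic zero makes the
    integers [c] distinct points. *)
Lemma resultant_common_zero (C : closedFieldType) (h : {rmorphism A -> C}) :
  injective (fun k => k%:R : C) -> h (lead_coef p) != 0 ->
  (forall c, (c <= size p * size fs)%N -> h (resultant p (pencil c)) = 0) ->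
  exists x, (map_poly h p).[x] = 0 /\ forall f, f \in fs -> (map_poly h f).[x]
    = 0.
Proof.
move=> natC_inj lead0 res0; set P := map_poly h p.
have P0 : P != 0 by exact: map_lead_neq0.
have [r rP] := closed_field_poly_normal P.
have rootP x : (x \in r) = root P x.
  by rewrite rP rootZ ?lead_coef_eq0 // root_prod_XsubC.
have sizer : (size r < size p)%N.
  have : (size P <= size p)%N by rewrite size_poly.
  by rewrite {1}rP size_scale ?lead_coef_eq0 // size_prod_XsubC.
pose Q x : {poly C} := \poly_(i < size fs) (map_poly h fs`_i).[x].
have hornerQ x c : (Q x).[c%:R] = \sum_(i < size fs) (map_poly h fs`_i).[x] *+
  c ^ i.
  by rewrite horner_poly; apply: eq_bigr => i _; rewrite -natrX mulr_natr.
have prod0 c : (c <= size p * size fs)%N -> (\prod_(x <- r) Q x).[c%:R] = 0.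
  move=> lec; have /eqP := res0 c lec; rewrite resultant_pencil0 //.
  move=> /gtn_eqF /negbT /closed_rootP [x];
    rewrite root_gcd -rootP => /andP[xr].
  have /eqP Px : root P x by rewrite -rootP.
  rewrite /root map_pencil Px mul0r add0r -hornerQ => Qx.
  by rewrite horner_prod (big_rem x) //= (eqP Qx) mul0r.
have size_prodQ : (size (\prod_(x <- r) Q x)%R <= (size p * size fs).+1)%N.
  apply: leq_trans (_ : (size r * size fs).+1 <= _)%N; last first.
    by rewrite ltnS leq_mul2r ltnW // orbT.
  elim: (r) => [|x s IHs]; first by rewrite big_nil size_poly1.
  rewrite big_cons mulSn; apply: leq_trans (size_polyMleq _ _) _.
  have sQ : (size (Q x) <= size fs)%N by exact: size_poly.
  rewrite -subn1 leq_subLR add1n; apply: leq_trans (leq_add sQ IHs) _.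
  by rewrite addnS ltnW.
have : \prod_(x <- r) Q x = 0.
  pose rs : seq C := [seq k%:R | k <- iota 0 (size p * size fs).+1].
  apply: (@roots_geq_poly_eq0 _ _ rs); last by rewrite size_map size_iota.
    apply/allP => x /mapP[k]; rewrite mem_iota ltnS => /andP[_ lek] ->.
    by rewrite /root prod0.
  by rewrite map_inj_uniq ?iota_uniq.
move/eqP; rewrite prodf_seq_eq0 => /hasP[x xr /eqP Qx0]; exists x; split.
  by have := xr; rewrite rootP => /eqP.
move=> f /(nthP 0)[i lti <-]; have /(congr1 (fun q : {poly C} => q`_i)) := Qx0.
by rewrite coef_poly lti coef0.
Qed.


End Elimination.

(** * Norms of resultants and pencils; shears acting on points *)

Lemma leq_fact_exp2 n : (n`! <= 2 ^ (n * n))%N.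
Proof.
elim: n => // n IHn; rewrite factS;
  apply: leq_trans (_ : 2 ^ n.+1 * 2 ^ (n * n) <= _)%N.
  by rewrite leq_mul // ltnW // ltn_expl.
by rewrite -expnD leq_exp2l //; nia.
Qed.

(** Leibniz expansion of a determinant of order [n <= 2 * L]: there are [n!] terms of norm at most
    [2 ^ (L * n)], and [n * n + L * n <= 6 * (L * L)]. *)
Lemma inorm_resultant m (p q : {poly ipoly m}) L :
  (inorm m.+1 p <= 2 ^ L)%N -> (inorm m.+1 q <= 2 ^ L)%N ->
  (inorm m (resultant p q) <= 2 ^ (6 * (L * L)))%N.
Proof.
move=> pL qL; rewrite /resultant; set n := ((size q).-1 + (size p).-1)%N.
have len : (n <= 2 * L)%N.
  have := size_inorm pL; have := size_inorm qL; rewrite /n.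
  by case: (size q) => [|u]; case: (size p) => [|v] /=; lia.
have entry i j : (inorm m (Sylvester_mx p q i j) <= 2 ^ L)%N.
  rewrite Sylvester_mxE; case: (split i) => k; case: (k <= j)%N;
    rewrite ?mulr0n ?mulr1n ?inorm0 //; by apply: leq_trans (inorm_coef _ _) _.
apply: leq_trans (inorm_sum _ _ _) _.
apply: leq_trans (_ : \sum_(s : 'S_n) 2 ^ (L * n) <= _)%N.
  apply: leq_sum => s _; apply: leq_trans (inormM _ _) _.
  have -> : inorm m ((-1) ^+ s) = 1%N.
    by case: (odd_perm s); rewrite ?expr0 ?expr1 ?inormN -[1]/(1%:~R) inorm_int.
  rewrite mul1n (leq_trans (inorm_prod _ _ _)) // expnM.
  rewrite -[n in (_ ^ n)%N]card_ord -prod_nat_const leq_prod // => i _;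
    exact: entry.
rewrite sum_nat_const card_Sn; apply: leq_trans (leq_mul (leq_fact_exp2 n)
  (leqnn _)) _.
by rewrite -expnD leq_exp2l //; nia.
Qed.

Lemma inorm_mulrn m (f : ipoly m) n : (inorm m (f *+ n) <= n * inorm m f)%N.
Proof.
elim: n => [|n IHn]; first by rewrite mulr0n inorm0.
by rewrite mulrS mulSn (leq_trans (inormD _ _)) // leq_add2l.
Qed.

Lemma inorm_pencil m (p : {poly ipoly m}) (fs : seq {poly ipoly m}) n c L :
  (inorm m.+1 p <= 2 ^ L)%N -> (forall f, f \in fs -> inorm m.+1 f <= 2 ^ L)%N
    ->
  (n <= L.+1)%N -> (c <= 2 ^ L)%N -> (size fs <= L)%N ->
  (inorm m.+1 (pencil p fs n c) <= 2 ^ (L * L + 3 * L + 2))%N.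
Proof.
move=> pL fsL nL cL sL; apply: leq_trans (inormD _ _) _; rewrite inormMXn.
apply: leq_trans (_ : 2 ^ (L * L + 3 * L + 1) + 2 ^ (L * L + 3 * L + 1) <= _)%N;
  last by rewrite addnn -mul2n -expnS leq_exp2l //; lia.
apply: leq_add.
  apply: leq_trans (leq_mul pL (leqnn _)) _; rewrite -expnD leq_exp2l //; nia.
apply: leq_trans (inorm_sum _ _ _) _.
apply: leq_trans (_ : \sum_(i < size fs) 2 ^ (L * L + L) <= _)%N.
  apply: leq_sum => i _; apply: leq_trans (inorm_mulrn _ _) _.
  rewrite expnD leq_mul ?fsL ?mem_nth // expnM.
  have lei : (i <= L)%N by rewrite (leq_trans _ sL) // ltnW.
  have : (c ^ i <= (2 ^ L) ^ i)%N.
    by case: (nat_of_ord i) => // k; rewrite leq_exp2r.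
  by move/leq_trans; apply; rewrite leq_pexp2l // expn_gt0.
rewrite sum_nat_const card_ord;
  apply: leq_trans (_ : 2 ^ L * 2 ^ (L * L + L) <= _)%N.
  by rewrite leq_mul // (leq_trans sL) // ltnW // ltn_expl.
by rewrite -expnD leq_exp2l //; nia.
Qed.

Definition common_zero (K : comNzRingType) m (fs : seq (ipoly m)) (z : seq K) :
  bool :=
  (size z == m) && all (fun f => ieval (nth 0 z) m f == 0) fs.

Section Shift.

Variables (K : comNzRingType) (L m : nat).

(** For [sg = 1] this is the action on points dual to [shear]; for [sg = -1] it is the inverse map,
    because the last coordinate is unchanged. *)
Definition shear_point (sg : K) (z : seq K) : seq K :=
  mkseq (fun i => if (i < m)%N then z`_i + sg * z`_m ^+ (L.+1 ^ i.+1) else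
    z`_i) m.+1.

Lemma nth_shear_point sg z i : (i < m.+1)%N -> (shear_point sg z)`_i =
  if (i < m)%N then z`_i + sg * z`_m ^+ (L.+1 ^ i.+1) else z`_i.
Proof. by move=> lti; rewrite nth_mkseq. Qed.

Lemma shear_pointK sg z : size z = m.+1 -> shear_point (- sg) (shear_point sg
  z) = z.
Proof.
move=> sz; apply: (@eq_from_nth _ 0); first by rewrite size_mkseq sz.
move=> i; rewrite size_mkseq => lti;
  rewrite nth_shear_point // !nth_shear_point // ltnn.
by case: ifP => lt; rewrite lt ?mulNr ?addrK.
Qed.

Lemma ieval_shear_point z (f : ipoly m.+1) :
  ieval (nth 0 (shear_point 1 z)) m.+1 f = ieval (nth 0 z) m.+1 (shear L m f).
Proof.
by rewrite ieval_shear; apply: eq_ieval => i lti;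
  rewrite nth_shear_point // mul1r.
Qed.

Lemma common_zero_shear (fs : seq (ipoly m.+1)) z : size z = m.+1 ->
  common_zero [seq shear L m f | f <- fs] z = common_zero fs (shear_point 1 z).
Proof.
move=> sz; rewrite /common_zero sz size_mkseq !eqxx /= all_map.
by apply: eq_all => f; exact: (congr1 (eq_op^~ 0) (esym (ieval_shear_point z
  f))).
Qed.

End Shift.

Lemma ieval_rcons (K : comNzRingType) m (f : ipoly m.+1) (y : seq K) x :
  size y = m ->
  ieval (nth 0 (rcons y x)) m.+1 f = (map_poly (ieval (nth 0 y) m) f).[x].
Proof.
move=> sy; rewrite ievalS nth_rcons sy ltnn eqxx.
congr (horner _ _); apply: eq_map_poly; apply: eq_ieval => i lti.
by rewrite nth_rcons sy lti.
Qed.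

(** * Solutions modulo p of a system with finitely many complex solutions *)

Lemma leq_size_allpairs (S T U : Type) (f : S -> T -> U) (s : seq S)
    (t : S -> seq T) n : (forall x, size (t x) <= n)%N ->
  (size [seq f x y | x <- s, y <- t x] <= size s * n)%N.
Proof.
move=> tn; elim: s => //= x s IHs.
by rewrite size_cat size_map mulSn leq_add.
Qed.

Lemma intr_neq0 (K : nzRingType) (a : int) : (a%:~R != 0 :> K) = (`|a|%:R != 0
  :> K).
Proof. by case: a => n //=; rewrite NegzE mulrNz oppr_eq0. Qed.

(** Bookkeeping for one elimination: [L * (L.+1 ^ m).+1] bounds the logarithmic norms after the
    shear, [Q] also the number of resultants, [Q2] the logarithmic norms of the pencils and
    [L ^ (8 * m + 25)] those of the resultants. *)
Lemma elimination_bounds m L : (1 < L)%N ->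
  let Q := (L ^ (2 * m + 4))%N in let Q2 := (L ^ (4 * m + 11))%N in
  [/\ L * (L.+1 ^ m).+1 < Q, (L * (L.+1 ^ m).+1).+1 * L <= Q,
      Q * Q + 3 * Q + 2 <= Q2 & 6 * (Q2 * Q2) <= L ^ (8 * m + 25)]%N.
Proof.
move=> L1 Q Q2; pose u := (L ^ (2 * m))%N.
have u0 : (0 < u)%N by rewrite expn_gt0 ltnW.
have LL : (L.+1 <= L * L)%N by nia.
have le1 : (L.+1 ^ m <= u)%N.
  rewrite /u expnM; case: (m) => // k; rewrite leq_exp2r // expnS expn1;
    exact: LL.
have eQ : Q = (u * (L * L * (L * L)))%N by rewrite /Q expnD !expnS expn0; lia.
have eQ2 : Q2 = (Q * Q * (L * L * L))%N.
  by rewrite /Q /Q2 !mulnA -!expnD -!expnSr; congr expn; lia.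
have -> : (L ^ (8 * m + 25))%N = (Q2 * Q2 * (L * L * L))%N.
  by rewrite /Q2 !mulnA -!expnD -!expnSr; congr expn; lia.
have Q0 : (0 < Q)%N by rewrite expn_gt0 ltnW.
have L3 : (8 <= L * L * L)%N by nia.
have L2 : (4 <= L * L)%N by nia.
have h : ((L * (L.+1 ^ m).+1).+1 <= u * L * 4)%N.
  apply: leq_trans (_ : (L * u.+1).+1 <= _)%N; last by nia.
  by rewrite ltnS leq_mul2l ltnS le1 orbT.
have h' : ((L * (L.+1 ^ m).+1).+1 * L <= Q)%N.
  apply: leq_trans (leq_mul h (leqnn L)) _; rewrite eQ.
  rewrite (_ : u * (L * L * (L * L)) = u * L * (L * L) * L)%N; last by lia.
  by rewrite leq_mul // leq_mul.
split=> //.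
- by apply: leq_trans h'; rewrite leq_pmulr // ltnW.
- by rewrite eQ2; nia.
by rewrite mulnC leq_mul // (leq_trans _ L3).
Qed.

(** Induction on [m], eliminating the last variable. Over [C] every zero of the eliminants lifts to
    a zero of the sheared system, so finiteness is inherited. Over [K] only the converse is used,
    namely that zeros project to zeros, and it needs just the leading coefficient [a] to survive. *)
Lemma finite_common_zeros (C : closedFieldType) m :
  injective (fun k => k%:R : C) ->
  exists k, forall L (fs : seq (ipoly m)), (1 < L)%N -> (size fs <= L)%N ->
    (forall f, f \in fs -> inorm m f <= 2 ^ L)%N ->
    (exists s : seq (seq C), forall z, common_zero fs z -> z \in s) ->
  exists B, [/\ (0 < B)%N, (B <= 2 ^ (L ^ k))%N &
    forall K : closedFieldType, B%:R != 0 :> K ->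
    exists2 s : seq (seq K), (size s <= L ^ k)%N &
      forall z, common_zero fs z -> z \in s].
Proof.
move=> natC_inj; elim: m => [|m [k IHm]].
  exists 0%N => L fs _ _ _ _; exists 1%N; split=> // K _.
  by exists [:: [::]] => // z /andP[/nilP ->].
(* [L ^ ((8 * m + 25) * k)] comes from the induction applied to the eliminants, [L ^ (8 * m + 25)]
   pays for the fibres and for [a], and the last factor [L >= 2] turns a sum into a product. *)
exists (1 + (8 * m + 25) + (8 * m + 25) * k)%N => L fs L1 sfs fsL [s fs_s].
have [Q1 Q2 Q3 Q4] := elimination_bounds m L1.
set b := (L * (L.+1 ^ m).+1)%N in Q1 Q2; set E := (8 * m + 25)%N in Q4 *.
set Q := (L ^ (2 * m + 4))%N in Q1 Q2 Q3;
  set Q' := (L ^ (4 * m + 11))%N in Q3 Q4.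
have E0 : (0 < E)%N by rewrite /E; lia.
clearbody E.
(* If all equations were zero, the points [(i, 0, ..., 0)] would be infinitely many common zeros. *)
have [f1 f1fs f1n0] : exists2 f, f \in fs & f != 0.
  apply/hasP; rewrite -[has _ _]negbK -all_predC; apply/negP => /allP fs0.
  pose pts := [seq (i%:R : C) :: nseq m 0 | i <- iota 0 (size s).+1].
  have pts_uniq : uniq pts.
    by rewrite map_inj_uniq ?iota_uniq // => i j [eij]; exact: natC_inj.
  have : {subset pts <= s}.
    move=> _ /mapP[i _ ->]; apply: fs_s.
    rewrite /common_zero [size _]/= size_nseq eqxx.
    by apply/allP => f /fs0 /negPn /eqP ->; apply/eqP; exact: rmorph0.
  by move/(uniq_leq_size pts_uniq); rewrite size_map size_iota ltnn.
pose gs : seq {poly ipoly m} := [seq shear L m f | f <- fs].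
pose p : {poly ipoly m} := shear L m f1.
have [a a0 lead_p] := shear_lead f1n0 (fsL _ f1fs).
rewrite -/p in lead_p.
have gsb g : g \in gs -> (inorm m.+1 g <= 2 ^ b)%N.
  by move=> /mapP[f /fsL ? ->]; apply: inorm_shear.
have pgs : p \in gs by apply: map_f.
have pb := gsb _ pgs.
have sgs : (size gs <= L)%N by rewrite size_map.
have size_gs g : g \in gs -> (size g <= b.+1)%N by move=> /gsb /size_inorm.
have sp := size_gs _ pgs.
have p0 : p != 0.
  apply: contraNneq a0 => p0.
  by rewrite -absz_eq0 -(inorm_int m a) -lead_p p0 lead_coef0 inorm0.
(* [T + 1] values of the parameter are what [resultant_common_zero] requires. *)
pose T := (size p * size gs)%N.
pose es := [seq resultant p (pencil p gs b.+1 c) | c <- iota 0 T.+1].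
have LE0 : (0 < L ^ E)%N by rewrite expn_gt0 ltnW.
have TQ : (T <= Q)%N by apply: leq_trans Q2; rewrite leq_mul.
have bQ : (2 ^ b <= 2 ^ Q)%N by rewrite leq_exp2l // ltnW.
have QQ' : (Q.+1 <= Q')%N by nia.
have QE : (Q.+1 <= L ^ E)%N by nia.
have es_size : (size es <= L ^ E)%N.
  by rewrite size_map size_iota; apply: leq_trans QE.
have es_norm e : e \in es -> (inorm m e <= 2 ^ (L ^ E))%N.
  move=> /mapP[c]; rewrite mem_iota ltnS => /= cT ->.
  apply: leq_trans (_ : 2 ^ (6 * (Q' * Q')) <= _)%N; last by rewrite leq_exp2l.
  apply: inorm_resultant.
    by apply: leq_trans pb _; rewrite leq_exp2l //; lia.
  apply: leq_trans (_ : 2 ^ (Q * Q + 3 * Q + 2) <= _)%N;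
    last by rewrite leq_exp2l.
  apply: inorm_pencil.
  - exact: leq_trans pb bQ.
  - by move=> g /gsb /leq_trans; apply.
  - by rewrite ltnS ltnW.
  - by rewrite (leq_trans cT) // (leq_trans TQ) // ltnW // ltn_expl.
  - by rewrite (leq_trans sgs) // (leq_trans _ Q2) // leq_pmull.
have hom_lead (K : comNzRingType) (y : nat -> K) : ieval y m (lead_coef p) =
  a%:~R.
  by rewrite lead_p rmorph_int.
have [||B' [B'0 B'le B'P]] := IHm (L ^ E)%N es _ es_size es_norm.
  apply: (leq_trans L1); rewrite -[X in (X <= _)%N]expn1.
  by apply: leq_pexp2l; [exact: ltnW |].
  (* A complex zero [y] of the eliminants extends to a zero [(y, x)] of the sheared system, whose
     image under the shear lies in [s]; undoing the shear and dropping the last coordinate returns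
     [y]. *)
  exists [seq take m (shear_point L m (- 1) z) | z <- s] => y /andP[/eqP sy
    /allP y0].
  have [|c cT|x [px gsx]] := @resultant_common_zero _ p gs b.+1 p0 size_gs C
    (ieval (nth 0 y) m) natC_inj.
  - rewrite hom_lead intr_neq0 -(mulr0n 1) (inj_eq natC_inj).
    by rewrite absz_eq0.
  - apply/eqP/(y0 (resultant p (pencil p gs b.+1 c)))/mapP; exists c => //.
    by rewrite mem_iota ltnS.
  have syx : size (rcons y x) = m.+1 by rewrite size_rcons sy.
  have : shear_point L m 1 (rcons y x) \in s.
    apply: fs_s; rewrite -common_zero_shear //; apply/andP; split;
      first exact/eqP.
    by apply/allP => g ggs; apply/eqP; rewrite ieval_rcons // gsx.
  move/(map_f (fun z => take m (shear_point L m (- 1) z))).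
  by rewrite shear_pointK // -cats1 take_size_cat.
exists (`|a| * B')%N; split.
- by rewrite muln_gt0 absz_gt0 a0.
- apply: leq_trans (_ : 2 ^ Q * 2 ^ ((L ^ E) ^ k) <= _)%N.
    rewrite leq_mul // (leq_trans _ bQ) // (leq_trans _ pb) //.
    by rewrite -(inorm_int m a) -lead_p inorm_coef.
  rewrite -expnD leq_exp2l // !expnD expn1 -expnM.
  have w0 : (0 < L ^ (E * k))%N by rewrite expn_gt0 ltnW.
  move: QE w0; set v := (L ^ E)%N; set w := (L ^ (E * k))%N => Qv w0.
  apply: leq_trans (_ : 2 * (v * w) <= _)%N; first by nia.
  by rewrite -mulnA leq_mul.
move=> K; rewrite natrM mulf_eq0 negb_or => /andP[aK B'K].
have aK0 : a%:~R != 0 :> K by rewrite intr_neq0.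
have [s' size_s' s'P] := B'P K B'K.
pose r (y : seq K) := projT1 (closed_field_poly_normal (map_poly (ieval (nth 0
  y) m) p)).
have rP y x : (map_poly (ieval (nth 0 y) m) p).[x] = 0 -> x \in r y.
  rewrite /r; case: closed_field_poly_normal => /= t tP.
  have P0 : map_poly (ieval (nth 0 y) m) p != 0.
    by apply: map_lead_neq0; rewrite hom_lead.
  by move/eqP; rewrite -/(root _ x) tP rootZ ?lead_coef_eq0 // root_prod_XsubC.
have size_r y : (size (r y) <= b)%N.
  rewrite /r; case: closed_field_poly_normal => /= t tP.
  have P0 : map_poly (ieval (nth 0 y) m) p != 0.
    by apply: map_lead_neq0; rewrite hom_lead.
  have : (size (map_poly (ieval (nth 0 y) m) p)%R <= b.+1)%N.
    by apply: leq_trans sp; rewrite size_poly.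
  by rewrite tP size_scale ?lead_coef_eq0 // size_prod_XsubC.
(* The zeros over [K] lie above [s'], and each fibre is contained in the roots of the specialised
   [p], which is nonzero because [a] is. *)
exists [seq shear_point L m 1 (rcons y x) | y <- s', x <- r y].
  apply: leq_trans (leq_size_allpairs _ _ size_r) _.
  rewrite !expnD expn1 -[X in (_ <= X)%N]mulnA.
  apply: leq_trans (_ : L ^ (E * k) * L ^ E <= _)%N;
    last by rewrite mulnC leq_pmull // ltnW.
  by rewrite leq_mul ?expnM // ltnW // (leq_trans _ QE) // ltnW.
move=> z z0; have /andP[/eqP sz _] := z0.
pose w := shear_point L m (- 1) z.
have sw : size w = m.+1 by rewrite size_mkseq.
have wz : shear_point L m 1 w = z by rewrite -[1]opprK shear_pointK.
have w0 : @common_zero K m.+1 gs w by rewrite common_zero_shear // wz.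
have ew : w = rcons (take m w) (nth 0 w m).
  by rewrite -take_nth ?sw // take_oversize ?sw.
have stw : size (take m w) = m by rewrite size_takel ?sw.
have homw g : g \in gs -> (map_poly (ieval (nth 0 (take m w)) m) g).[nth 0 w m]
  = 0.
  move=> ggs; rewrite -ieval_rcons // -ew; have /andP[_ /allP w0'] := w0.
  exact/eqP/w0'.
rewrite -wz ew; apply: (@allpairs_f_dep _ _ _ (fun y x => shear_point L m 1
  (rcons y x))).
  apply: s'P; rewrite /common_zero stw eqxx; apply/allP => e /mapP[c _ ->].
  apply/eqP; apply: (@common_zero_resultant _ p gs b.+1 p0 size_gs K _ _ (nth 0
    w m)).
  - by rewrite hom_lead.
  - exact: homw.
  - exact: homw.
by apply: rP; apply: homw.
Qed.

(** * Unique factorisation *)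

Section Factorial.

Variable A : idomainType.
Implicit Types a b c p q : A.

Definition divides a b := exists c, b = a * c.

Definition prime_elt p := [/\ p != 0, p \isn't a GRing.unit &
  forall a b, divides p (a * b) -> divides p a \/ divides p b].

Definition irred_elt p := [/\ p != 0, p \isn't a GRing.unit &
  forall a b, p = a * b -> a \is a GRing.unit \/ b \is a GRing.unit].

(** The measure, which strictly drops when a nonunit factor is removed, encodes the existence of
    factorisations; primality of irreducible elements encodes uniqueness. *)
Definition factorial := (exists mu : A -> nat,
    forall a b, a * b != 0 ->
      (mu b <= mu (a * b)%R)%N /\
      (a \isn't a GRing.unit -> (mu b < mu (a * b)%R)%N)) /\
  forall p, irred_elt p -> prime_elt p.

Lemma dividesMr a b c : divides a b -> divides a (b * c).
Proof. by case=> d ->; exists (d * c); rewrite mulrA. Qed.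

Lemma dividesMl a b c : divides a c -> divides a (b * c).
Proof. by rewrite mulrC; apply: dividesMr. Qed.

Lemma dividesD a b c : divides a b -> divides a c -> divides a (b + c).
Proof. by case=> d -> [e ->]; exists (d + e); rewrite mulrDr. Qed.

Lemma divides_addr a b c : divides a b -> divides a (b + c) -> divides a c.
Proof.
move=> [d ->] [e eq]; exists (e - d); rewrite mulrBr -eq.
by rewrite addrAC subrr add0r.
Qed.

Lemma divides_sum a (I : Type) (r : seq I) (P : pred I) (F : I -> A) :
  (forall i, P i -> divides a (F i)) -> divides a (\sum_(i <- r | P i) F i).
Proof.
move=> dvd; elim/big_rec: _ => [|i b Pi]; first by exists 0; rewrite mulr0.
exact/dividesD/dvd.
Qed.

(** A nonzero nonunit has an irreducible, hence prime, factor, and the cofactor has smaller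
    measure. *)
Lemma factorial_ind : factorial -> forall P : A -> Prop,
  (forall u, u \is a GRing.unit -> P u) ->
  (forall p a, prime_elt p -> a != 0 -> P a -> P (p * a)) ->
  forall a, a != 0 -> P a.
Proof.
move=> [[mu muP] irrP] P Pu Pp a; have [n] := ubnP (mu a).
elim: n a => // n IHn a ltn a0.
have [/Pu //|nua] := boolP (a \is a GRing.unit).
suff [p [b [pp eab b0]]] : exists p b, [/\ prime_elt p, a = p * b & b != 0].
  rewrite eab in a0 ltn *; apply: Pp => //; apply: IHn => //.
  have [_ nu _] := pp; have [_ /(_ nu) lt] := muP _ _ a0.
  exact: leq_trans lt _.
(* an irreducible factor, found by descent on the measure *)
have [k] := ubnP (mu a); elim: k a {IHn ltn} a0 nua => // k IHk a a0 nua ltk.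
have [/irrP pa|nirr] := pselect (irred_elt a).
  by exists a, 1; rewrite mulr1 oner_neq0.
have [b [c [eabc nub nuc]]] : exists b c,
    [/\ a = b * c, b \isn't a GRing.unit & c \isn't a GRing.unit].
  apply: contrapT => nex; apply: nirr; split=> // b c eabc.
  have [|nub] := boolP (b \is a GRing.unit); first by left.
  have [|nuc] := boolP (c \is a GRing.unit); first by right.
  by case: nex; exists b, c.
rewrite eabc in a0 ltk; have [b0 c0] : b != 0 /\ c != 0.
  by apply/andP; rewrite -negb_or -mulf_eq0.
have [_ /(_ nub) ltc] := muP _ _ a0.
have [|p [d [pp ecd d0]]] := IHk c c0 nuc; first exact: leq_trans ltc _.
by exists p, (b * d); rewrite mulf_neq0 // eabc ecd mulrCA.
Qed.

(** Induction on the prime factors of [g]: each divides [f * b] but not [f], hence divides [b] and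
    can be cancelled. *)
Lemma coprime_divides f g a b : factorial ->
  (forall d e e', f = d * e -> g = d * e' -> d \is a GRing.unit) ->
  g != 0 -> f * b = a * g -> divides g b.
Proof.
move=> facA cop g0; move: g g0 cop a b.
apply: (factorial_ind facA) => [u uu|p g pp g0 IHg] cop a b efb.
  by exists (u^-1 * b); rewrite mulVKr.
have [p0 nup prP] := pp.
have [|[c efc]|[c ebc]] := prP f b; first by rewrite efb mulrCA;
  apply: dividesMr; exists 1; rewrite mulr1.
  by case/negP: nup; apply: cop efc _.
have [||d ed] := IHg _ a c.
- by move=> d e e' ef eg; apply: (cop d e (p * e')) => //; rewrite eg mulrCA.
- by apply: (mulfI p0); rewrite mulrCA -ebc efb mulrCA.
by exists d; rewrite ebc ed mulrA.
Qed.

End Factorial.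

(** For irreducible [p], the factor [gcdz p a] is either a unit, and Gauss's divisibility lemma
    applies, or associated to [p], which then divides [a]. *)
Lemma factorial_int : factorial int.
Proof.
split.
  exists absz => a b; rewrite mulf_eq0 negb_or => /andP[a0 b0]; rewrite abszM.
  have la : (0 < `|a|)%N by rewrite absz_gt0.
  have lb : (0 < `|b|)%N by rewrite absz_gt0.
  split; first by rewrite leq_pmull.
  move=> nua; rewrite ltn_Pmull // ltn_neqAle la andbT eq_sym.
  apply: contra nua => /eqP a1; apply/unitrP; exists a.
  by rewrite -expr2 -real_normK ?num_real // -abszE a1 expr1n.
move=> p [p0 nup irr]; split=> // a b [c eab].
have [q epq] : exists q, p = gcdz p a * q.
  by exists (p %/ gcdz p a)%Z; rewrite mulrC divzK // dvdz_gcdl.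
have [gu|qu] := irr _ _ epq.
  have cop : coprimez p a.
    have /unitrP[v [gv1 _]] := gu.
    have : (gcdz p a %| 1)%Z by apply/dvdzP; exists v; rewrite gv1.
    by rewrite dvdz1 /coprimez => /eqP g1;
      rewrite -[gcdz p a]/(Posz `|gcdz p a|%N) g1.
  right; have : (p %| a * b)%Z by rewrite eab dvdz_mulr.
  by rewrite Gauss_dvdzr // => /dvdzP[d ->]; exists d; rewrite mulrC.
left; have /dvdzP[d ed] := dvdz_gcdr p a.
by exists (q^-1 * d); rewrite {1}epq mulrA mulrK // mulrC.
Qed.

(** * Gauss's lemma: polynomials over a factorial domain *)

Section FactorialPoly.

Variable A : idomainType.
Hypothesis facA : factorial A.

Lemma polyC_unit (c : A) : (c%:P \is a GRing.unit) = (c \is a GRing.unit).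
Proof.
rewrite poly_unitE coefC eqxx size_polyC.
by have [->|//] := eqVneq c 0; rewrite unitr0 andbF.
Qed.

Lemma divides_polyC (c : A) (f : {poly A}) :
  (forall i, divides c f`_i) -> divides c%:P f.
Proof.
move=> dvd; exists (\poly_(i < size f) projT1 (cid (dvd i))).
apply/polyP => i; rewrite coefCM coef_poly; case: ltnP => [lti|lei].
  by case: (cid (dvd i)).
by rewrite mulr0 nth_default.
Qed.

(** Take the first coefficients [f_i] and [g_j] not divisible by [c]: modulo [c], the coefficient of
    index [i + j] of [f * g] is [f_i * g_j]. *)
Lemma prime_polyC (c : A) : prime_elt c -> prime_elt c%:P.
Proof.
move=> [c0 nuc prc]; split; rewrite ?polyC_eq0 ?polyC_unit // => f g dvdfg.
have coef_dvd k : divides c (f * g)`_k.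
  by case: dvdfg => h ->; rewrite coefCM; exists h`_k.
have firstP (h : {poly A}) : ~ divides c%:P h ->
    exists2 i, ~ divides c h`_i & forall j, (j < i)%N -> divides c h`_j.
  move=> nh; have ex : exists i, `[< ~ divides c h`_i >].
    apply: contrapT => nex; apply: nh; apply: divides_polyC => i.
    by apply: contrapT => ni; apply: nex; exists i; apply/asboolP.
  have [i /asboolP ni mini] := ex_minnP ex; exists i => // j ltji.
  apply: contrapT => nj; have := mini j; rewrite leqNgt ltji.
  by move/(_ (asboolT nj)).
apply: contrapT => /not_orP[/firstP[i ni mini] /firstP[j nj minj]].
have lti : (i < (i + j).+1)%N by rewrite ltnS leq_addr.
have := coef_dvd (i + j)%N; rewrite coefM (bigD1 (Ordinal lti)) //= addKn addrC.
move=> dvd.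
have [] // : divides c f`_i \/ divides c g`_j.
apply: prc; apply: (divides_addr _ dvd); apply: divides_sum => k neqk.
have [ltk|] := ltnP k i; first exact/dividesMr/mini.
rewrite leq_eqVlt => /orP[/eqP eik|ltk].
  by case/eqP: neqk; apply: val_inj.
apply/dividesMl/minj; rewrite ltn_subLR ?ltn_add2r //.
by rewrite -ltnS.
Qed.

(** The prime factors of [c] remain prime as constant polynomials, so each can be removed from [s]
    or from [q]. This replaces passing to the fraction field. *)
Lemma split_polyC (c : A) (b s q : {poly A}) : c != 0 -> c%:P * b = s * q ->
  exists c1 c2 s' q', [/\ b = s' * q', s = c1%:P * s' & q = c2%:P * q'].
Proof.
move=> c0; move: c c0 b s q.
apply: (factorial_ind facA) => [u uu|p c pp c0 IHc] b s q eq.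
  exists u, 1, (u^-1%:P * s), q; split; rewrite ?mul1r //.
    by rewrite -mulrA -eq mulrA -polyCM mulVr ?mul1r.
  by rewrite mulrA -polyCM mulrV ?mul1r.
have [p0 _ prp] := prime_polyC pp; rewrite polyCM -mulrA in eq.
have [|[s1 es]|[q1 eq1]] := prp s q; first by rewrite -eq; exists (c%:P * b).
  have [|c1 [c2 [s' [q' [-> es' ->]]]]] := IHc b s1 q.
    by apply: (mulfI p0); rewrite eq es mulrA.
  by exists (p * c1), c2, s', q'; rewrite es es' polyCM mulrA.
have [|c1 [c2 [s' [q' [-> -> eq']]]]] := IHc b s q1.
  by apply: (mulfI p0); rewrite eq eq1 mulrCA.
by exists c1, (p * c2), s', q'; rewrite eq1 eq' polyCM mulrA.
Qed.

Lemma irred_divides_cancel (p x t : {poly A}) (c : A) :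
  irred_elt p -> (1 < size p)%N -> c != 0 -> c%:P * x = p * t -> divides p x.
Proof.
move=> [p0 nup irp] sp c0 /(split_polyC c0)[c1 [c2 [s' [q' [-> ep _]]]]].
have [c1u|s'u] := irp _ _ ep.
  by exists (c1%:P^-1 * q'); rewrite ep -mulrA [RHS]mulrCA mulVKr.
suff : (size p <= 1)%N by rewrite leqNgt sp.
move: s'u; rewrite poly_unitE => /andP[/eqP s1 _]; rewrite ep.
by apply: leq_trans (size_polyMleq _ _) _; rewrite s1 addn1 /= size_polyC_leq1.
Qed.

(** A nonzero [h] of least degree in the ideal [(p, f)] divides every element of it up to a constant
    factor. Hence [p = s' * q'] with [h = c1 * s']. If [q'] is a unit, [p] divides a constant
    multiple of [f], hence [f]. If [s'] is a unit, [c1] lies in [(p, f)], so [p] divides [c1 * g],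
    hence [g]. *)
Lemma irred_prime_nonconst (p : {poly A}) :
  irred_elt p -> (1 < size p)%N -> prime_elt p.
Proof.
move=> irrp sp; have [p0 nup irp] := irrp; split=> // f g [k efg].
have [|ndvd] := pselect (divides p f); [by left | right].
pose I (h : {poly A}) := exists u v, h = u * p + v * f.
have ex : exists n, `[< exists h, [/\ I h, h != 0 & size h = n] >].
  exists (size p); apply/asboolP; exists p; split=> //.
  by exists 1, 0; rewrite mul1r mul0r addr0.
have [n /asboolP[h [[u [v eh]] h0 sh]] minn] := ex_minnP ex.
(* Pseudo-division by [h]: the remainder stays in the ideal and has smaller size, so it vanishes by
   minimality. *)
have divI x : I x -> exists c t, c != 0 /\ c%:P * x = h * t.
  move=> [u' [v' ex']]; exists (lead_coef h ^+ scalp x h), (x %/ h).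
  rewrite expf_neq0 ?lead_coef_eq0 // mul_polyC Pdiv.Idomain.divp_eq.
  split=> //; rewrite [h * _]mulrC; apply/eqP;
    rewrite -subr_eq0 addrAC subrr add0r.
  apply/negPn/negP => r0; have lt : (size (x %% h)%R < size h)%N.
    by rewrite Pdiv.Idomain.ltn_modp.
  have := minn (size (x %% h)); rewrite leqNgt -sh lt => /(_ _)/negP;
    apply=> //.
  apply/asboolP; exists (x %% h); split=> //; set c := lead_coef h ^+ scalp x h.
  exists (c *: u' - x %/ h * u), (c *: v' - x %/ h * v).
  have := Pdiv.Idomain.divp_eq x h; rewrite -/c => /eqP;
    rewrite addrC -subr_eq => /eqP <-.
  by rewrite ex' {2}eh -mul_polyC -!mul_polyC; ring.
have [c [q1 [c0 ep]]] : exists c t, c != 0 /\ c%:P * p = h * t.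
  by apply: divI; exists 1, 0; rewrite mul1r mul0r addr0.
have [c' [q2 [c'0 ef]]] : exists c t, c != 0 /\ c%:P * f = h * t.
  by apply: divI; exists 0, 1; rewrite mul1r mul0r add0r.
have [c1 [c2 [s' [q' [ep' eh' _]]]]] := split_polyC c0 ep.
have [s'u|q'u] := irp _ _ ep'; last first.
  case: ndvd; apply: (@irred_divides_cancel p f (q'^-1 * c1%:P * q2) c') => //.
  by rewrite ef eh' ep' -!mulrA mulVKr //; ring.
have c10 : c1 != 0.
  by apply: contraNneq h0 => c10; rewrite eh' c10 mul0r.
apply: (@irred_divides_cancel p g (s'^-1 * (u * g + v * k)) c1) => //.
have -> : c1%:P = s'^-1 * h by rewrite eh' mulrCA mulVr ?mulr1.
rewrite eh -mulrA [RHS]mulrCA; congr (_ * _).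
by rewrite mulrDl -[v * f * g]mulrA efg; ring.
Qed.

(** In the measure, the size accounts for nonconstant factors and the measure of the leading
    coefficient for constant nonunit ones. *)
Lemma factorial_poly : factorial {poly A}.
Proof.
have [[mu muP] irrP] := facA; split; last first.
  move=> p irp; have [p0 nup prp] := irp.
  have [sp1|] := leqP (size p) 1; last exact: irred_prime_nonconst.
  have ep := size1_polyC sp1; rewrite ep; apply: prime_polyC; apply: irrP.
  rewrite ep polyC_eq0 polyC_unit in p0 nup; split=> // a b eab.
  by rewrite -!polyC_unit; apply: prp; rewrite ep eab polyCM.
exists (fun f : {poly A} => size f + mu (lead_coef f))%N => a b ab0.
have /andP[a0 b0] : (a != 0) && (b != 0) by rewrite -negb_or -mulf_eq0.
have [|le lt] := muP (lead_coef a) (lead_coef b).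
  by rewrite -lead_coefM lead_coef_eq0.
have sa : (0 < size a)%N by rewrite size_poly_gt0.
rewrite lead_coefM size_mul //; split.
  by rewrite leq_add //; lia.
move=> nua; have [sa1|sa1] := leqP (size a) 1; last first.
  by rewrite -addSn leq_add //; lia.
have ea := size1_polyC sa1.
rewrite -addnS leq_add //; first by lia.
by apply: lt; rewrite ea lead_coefC -polyC_unit -ea.
Qed.

End FactorialPoly.

Lemma factorial_ipoly m : factorial (ipoly m).
Proof. by elim: m => [|m IHm]; [exact: factorial_int | exact: factorial_poly].
  Qed.

(** * Iterates with a common denominator *)

Section Evaluation.

Variable m : nat.
Implicit Types F G : intpoly m.

Definition zev (K : comNzRingType) (w : 'I_m -> K) : {rmorphism intpoly m -> K}
  :=
  (@meval m K w \o map_mpoly (intr : int -> K) : {rmorphism intpoly m -> K}).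

Lemma zevE (K : comNzRingType) F (w : 'I_m -> K) : zeval F w = zev w F.
Proof. by []. Qed.

Lemma zevalM (K : comNzRingType) F G (w : 'I_m -> K) :
  zeval (F * G) w = zeval F w * zeval G w.
Proof. exact: (rmorphM (zev w)). Qed.

Lemma zevalB (K : comNzRingType) F G (w : 'I_m -> K) :
  zeval (F - G) w = zeval F w - zeval G w.
Proof. exact: (rmorphB (zev w)). Qed.

Lemma zeval_sum (K : comNzRingType) F (w : 'I_m -> K) :
  zeval F w = \sum_(a <- msupp F) (mcoeff a F)%:~R * \prod_i w i ^+ a i.
Proof.
rewrite zevE [in LHS](mpolyE F) rmorph_sum; apply: eq_bigr => a _.
by rewrite /= map_mpolyZ /= map_mpolyX mevalZ mevalX.
Qed.

Lemma rmorph_zeval (K K' : comNzRingType) (g : {rmorphism K -> K'}) F (w : 'I_m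
  -> K) :
  g (zeval F w) = zeval F (g \o w).
Proof.
rewrite !zeval_sum rmorph_sum; apply: eq_bigr => a _.
rewrite rmorphM rmorph_int rmorph_prod; congr (_ * _).
by apply: eq_bigr => i _; rewrite rmorphXn.
Qed.

Lemma eq_zeval (K : comNzRingType) F (v w : 'I_m -> K) :
  v =1 w -> zeval F v = zeval F w.
Proof. by move=> vw; apply: meval_eq. Qed.

Lemma zeval_X (K : comNzRingType) (w : 'I_m -> K) i : zeval (mpolyX int (mnm1
  i)) w = w i.
Proof. by rewrite /zeval map_mpolyX mevalXU. Qed.

Lemma zeval_id F : zeval F (fun i => mpolyX int (mnm1 i)) = F.
Proof.
rewrite zeval_sum [RHS]mpolyE; apply: eq_bigr => a _.
by rewrite mpolyXE_id mulrzl -[in RHS](intz (mcoeff a F)) scaler_int.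
Qed.

Lemma zfracE F : zfrac F = zeval F (@rX m).
Proof.
rewrite /zfrac -[@rX m]/(@FracField.tofrac (mpoly m rat) \o fun i => mpolyX rat
  (mnm1 i)).
rewrite -rmorph_zeval; apply: (congr1 (@FracField.tofrac (mpoly m rat))).
rewrite zeval_sum {1}(mpolyE F) rmorph_sum; apply: eq_bigr => a _.
by rewrite /= map_mpolyZ /= map_mpolyX mpolyXE_id mulrzl scaler_int.
Qed.

(** The homogenisation of [F] in degree [e], evaluated at [(u, v)]: it clears the denominators of
    [F(u / v)], provided that [e] is at least the degree of [F]. *)
Definition hev (K : comNzRingType) (e : nat) F (u : 'I_m -> K) (v : K) : K :=
  \sum_(a <- msupp F)
    (mcoeff a F)%:~R * (\prod_i u i ^+ a i) * v ^+ (e - mdeg a).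

Lemma rmorph_hev (K K' : comNzRingType) (g : {rmorphism K -> K'}) e F u (v : K)
  :
  g (hev e F u v) = hev e F (g \o u) (g v).
Proof.
rewrite rmorph_sum; apply: eq_bigr => a _.
rewrite !rmorphM rmorph_int rmorph_prod rmorphXn; congr (_ * _ * _).
by apply: eq_bigr => i _; rewrite rmorphXn.
Qed.

Lemma eq_hev (K : comNzRingType) e F (u u' : 'I_m -> K) v :
  u =1 u' -> hev e F u v = hev e F u' v.
Proof.
move=> uu'; apply: eq_bigr => a _; congr (_ * _ * _).
by apply: eq_bigr => i _; rewrite uu'.
Qed.

Lemma mdeg_pdeg F a e : (pdeg F <= e)%N -> a \in msupp F -> (mdeg a <= e)%N.
Proof.
move=> le aF; apply: leq_trans le; rewrite /pdeg -ltnS.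
have lt := msize_mdeg_lt aF; rewrite prednK //.
exact: leq_ltn_trans (leq0n _) lt.
Qed.

Lemma hevE (K : fieldType) e F (u : 'I_m -> K) v : (pdeg F <= e)%N -> v != 0 ->
  hev e F u v = v ^+ e * zeval F (fun i => u i / v).
Proof.
move=> le v0; rewrite zeval_sum mulr_sumr [LHS]big_seq [RHS]big_seq.
apply: eq_bigr => a /(mdeg_pdeg le) lea; rewrite mulrCA -mulrA; congr (_ * _).
under [in RHS]eq_bigr do rewrite exprMn exprVn.
rewrite big_split /= mulrCA; congr (_ * _).
rewrite prodfV -expr_sum -mdegE.
have -> : v ^+ e = v ^+ (e - mdeg a) * v ^+ mdeg a by rewrite -exprD subnK.
by rewrite mulfK // expf_neq0.
Qed.

End Evaluation.

(** * Unique factorisation transported to multivariate polynomials, and reduced fractions *)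

Section FactorialTransport.

Variable m : nat.
Implicit Types F G : intpoly m.

Definition xvar (i : 'I_m) : ipoly m := var m i.

Definition ext (K : comNzRingType) (w : 'I_m -> K) (n : nat) : K :=
  if insub n is Some i then w i else 0.

Lemma ieval_zeval (K : comNzRingType) (w : 'I_m -> K) (x : nat -> K) F :
  (forall i : 'I_m, x i = w i) -> ieval x m (zeval F xvar) = zeval F w.
Proof.
by move=> xw; rewrite rmorph_zeval; apply: eq_zeval => i; rewrite /= ieval_var.
Qed.

Lemma ext_ord (K : comNzRingType) (w : 'I_m -> K) (i : 'I_m) : ext w i = w i.
Proof. by rewrite /ext valK. Qed.

Definition of_ipoly : {rmorphism ipoly m -> intpoly m} :=
  ieval (ext (fun i => mpolyX int (mnm1 i))) m.

Lemma of_ipolyK F : of_ipoly (zeval F xvar) = F.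
Proof. by rewrite (@ieval_zeval _ (fun i => mpolyX int (mnm1 i)) _ F (@ext_ord
  _ _)) zeval_id. Qed.

Lemma zeval_of_ipoly (f : ipoly m) : zeval (of_ipoly f) xvar = f.
Proof.
move: f; apply: (@ipoly_rmorph_ext m (ipoly m) (zev xvar \o of_ipoly) idfun) =>
  j ltj.
rewrite [LHS]/(zeval (of_ipoly (var m j)) xvar) /of_ipoly ieval_var //.
rewrite -[j]/(val (Ordinal ltj)) ext_ord; exact: zeval_X.
Qed.

(** The mutually inverse maps [zev xvar] and [of_ipoly] carry coprimality to [ipoly m], where
    [coprime_divides] applies. *)
Lemma coprime_poly_divides F G A B : coprime_poly F G -> G != 0 ->
  F * B = A * G -> exists Q, B = G * Q.
Proof.
move=> cop G0 eFB; have inj : injective (fun F => zeval F xvar).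
  exact: can_inj of_ipolyK.
have [|||q eq] := @coprime_divides _ (zev xvar F) (zev xvar G) (zev xvar A)
  (zev xvar B)
    (factorial_ipoly m).
- move=> d e e' /(congr1 of_ipoly) ef /(congr1 of_ipoly) eg.
  rewrite rmorphM of_ipolyK in ef; rewrite rmorphM of_ipolyK in eg.
  by rewrite -[d]zeval_of_ipoly; apply: (rmorph_unit (zev xvar));
    apply: cop ef eg.
- by apply: contraNneq G0 => G0; apply/eqP/inj;
    exact: etrans G0 (esym (rmorph0 (zev xvar))).
- by rewrite -!rmorphM eFB.
by exists (of_ipoly q); apply: inj; rewrite /= zevalM zeval_of_ipoly; exact: eq.
Qed.

Lemma zfrac_div_eq F G A B : G != 0 -> B != 0 ->
  zfrac F / zfrac G = zfrac A / zfrac B -> F * B = A * G.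
Proof.
move=> G0 B0 /eqP; rewrite eqr_div ?zfrac_eq0 // -!zfracM => /eqP eq.
apply/eqP; rewrite -subr_eq0 -zfrac_eq0 zfracE zevalB -!zfracE.
by rewrite eq subrr.
Qed.

Lemma lowest_terms_numden (f : ratfun m) : lowest_terms f (num f, den f).
Proof. by rewrite /num /den; case: cid => -[]. Qed.

Lemma numden_quot (f : ratfun m) A B : B != 0 -> f = zfrac A / zfrac B ->
  num f * B = A * den f.
Proof.
move=> B0 ef; have [/= G0 _ ef'] := lowest_terms_numden f.
by apply: zfrac_div_eq => //; rewrite -ef -ef'.
Qed.

Lemma den_divides (f : ratfun m) A B : B != 0 -> f = zfrac A / zfrac B ->
  exists Q, B = den f * Q.
Proof.
move=> B0 ef; have [/= G0 cop _] := lowest_terms_numden f.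
exact: coprime_poly_divides cop G0 (numden_quot B0 ef).
Qed.

End FactorialTransport.

Section Iterates.

Variables (m : nat) (S : 'I_m -> ratfun m) (d : nat).
Hypothesis deg_S : forall i, (rdeg (S i) <= d)%N.

(* Numerators and common denominator of the iterates at x, not reduced to
   lowest terms. *)
Fixpoint frac_iter (K : comNzRingType) (x : 'I_m -> K) (k : nat) :
    ('I_m -> K) * K :=
  if k is k'.+1 then
    let: (a, b) := frac_iter x k' in
    (fun i => hev d (num (S i)) a b * \prod_(j | j != i) hev d (den (S j)) a b,
     \prod_j hev d (den (S j)) a b)
  else (x, 1).

Lemma frac_iterS (K : comNzRingType) (x : 'I_m -> K) k :
  frac_iter x k.+1 =
    (fun i => hev d (num (S i)) (frac_iter x k).1 (frac_iter x k).2 *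
        \prod_(j | j != i) hev d (den (S j)) (frac_iter x k).1 (frac_iter x
          k).2,
     \prod_j hev d (den (S j)) (frac_iter x k).1 (frac_iter x k).2).
Proof. by rewrite /=; case: frac_iter. Qed.

(** The recursion uses ring operations only, so a single formula serves for integer polynomials, for
    rational functions and for values over any field. *)
Lemma rmorph_frac_iter (K K' : comNzRingType) (g : {rmorphism K -> K'})
    (x : 'I_m -> K) (y : 'I_m -> K') k : g \o x =1 y ->
  (forall i, g ((frac_iter x k).1 i) = (frac_iter y k).1 i) /\
  g (frac_iter x k).2 = (frac_iter y k).2.
Proof.
move=> xy; elim: k => [|k [IH1 IH2]]; first by rewrite /= rmorph1.
have hevg F : g (hev d F (frac_iter x k).1 (frac_iter x k).2) =
              hev d F (frac_iter y k).1 (frac_iter y k).2.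
  by rewrite rmorph_hev IH2; apply: eq_hev => i; rewrite /= IH1.
rewrite !frac_iterS /=; split=> [i|]; last first.
  by rewrite rmorph_prod; apply: eq_bigr => j _.
by rewrite rmorphM rmorph_prod hevg; congr (_ * _); apply: eq_bigr => j _.
Qed.

(** Homogenising all numerators and denominators in the same degree [d] produces the same factor
    [b ^+ d], which cancels in the quotient. *)
Lemma frac_iter_step (K : fieldType) (x v : 'I_m -> K) k :
  (frac_iter x k).2 != 0 ->
  (forall i, v i = (frac_iter x k).1 i / (frac_iter x k).2) ->
  (forall i, zeval (den (S i)) v != 0) ->
  (frac_iter x k.+1).2 != 0 /\
  forall i, zeval (num (S i)) v / zeval (den (S i)) v =
            (frac_iter x k.+1).1 i / (frac_iter x k.+1).2.
Proof.
rewrite frac_iterS /=; set a := _.1; set b := _.2 => b0 ev den0.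
have hevF F : (pdeg F <= d)%N -> hev d F a b = b ^+ d * zeval F v.
  by move=> le; rewrite hevE //; congr (_ * _); apply: eq_zeval => i;
    rewrite ev.
have bd0 : b ^+ d != 0 by rewrite expf_neq0.
have hden i : hev d (den (S i)) a b != 0.
  by rewrite hevF ?mulf_neq0 // (leq_trans _ (deg_S i)) // leq_maxr.
split=> [|i]; first by apply/prodf_neq0.
have P0 : \prod_(j | j != i) hev d (den (S j)) a b != 0 by apply/prodf_neq0.
rewrite [X in _ = _ / X](bigD1 i) //= -[RHS]mulf_div divff // mulr1.
rewrite !hevF ?(leq_trans _ (deg_S i)) ?leq_maxr ?leq_maxl //.
by rewrite -mulf_div divff // mul1r.
Qed.

Lemma frac_iter_orbit (K : fieldType) (w v : {ffun 'I_m -> K}) k :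
  orbit_point S w k = Some v ->
  (frac_iter w k).2 != 0 /\
  forall i, v i = (frac_iter w k).1 i / (frac_iter w k).2.
Proof.
elim: k v => [|k IHk] v; first by case=> <-; rewrite /= oner_neq0;
  split=> // i; rewrite divr1.
rewrite /orbit_point iterS -/(orbit_point S w k).
case ev': (orbit_point S w k) => [v'|//] /=; rewrite /step.
case: ifP => // /forallP den0 [<-]; have [b0 e] := IHk _ ev'.
have [b1 e1] := frac_iter_step b0 e den0; split=> // i.
by rewrite ffunE e1.
Qed.

Lemma frac_iter_iterate k : iterate_defined S k ->
  (frac_iter (@rX m) k).2 != 0 /\
  forall i, iterate S k i = (frac_iter (@rX m) k).1 i / (frac_iter (@rX m) k).2.
Proof.
elim: k => [|k IHk] def; first by rewrite /= oner_neq0; split=> // i;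
  rewrite divr1.
have [|b0 e] := IHk; first by move=> j ltj; apply: def; apply: ltnW.
by apply: frac_iter_step => // i; apply: def.
Qed.

Definition mvar (i : 'I_m) : intpoly m := mpolyX int (mnm1 i).

Lemma zeval_frac_iter (K : comNzRingType) (w : 'I_m -> K) k :
  (forall i, zeval ((frac_iter mvar k).1 i) w = (frac_iter w k).1 i) /\
  zeval (frac_iter mvar k).2 w = (frac_iter w k).2.
Proof.
by apply: (rmorph_frac_iter (g := zev w)) => i; apply: zeval_X.
Qed.

Lemma iterate_quot k : iterate_defined S k ->
  (frac_iter mvar k).2 != 0 /\
  forall i, iterate S k i = zfrac ((frac_iter mvar k).1 i) / zfrac (frac_iter
    mvar k).2.
Proof.
move=> /frac_iter_iterate[b0 e]; have [e1 e2] := zeval_frac_iter (@rX m) k.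
by split=> [|i]; [rewrite -zfrac_eq0 zfracE e2 | rewrite e !zfracE e1 e2].
Qed.

Lemma value_iterate (K : fieldType) (w : {ffun 'I_m -> K}) k :
  iterate_defined S k -> defined_at (iterate S k) w -> (frac_iter w k).2 != 0 ->
  forall i, value (iterate S k) w i = (frac_iter w k).1 i / (frac_iter w k).2.
Proof.
move=> /iterate_quot[B0 e] /forallP den0 b0 i; rewrite ffunE.
have [e1 e2] := zeval_frac_iter w k.
have /(congr1 (fun F => zeval F w)) := numden_quot B0 (e i).
rewrite !zevalM e1 e2 => eq.
by apply/eqP; rewrite eqr_div // eq.
Qed.

(** Over the integers the reduced denominator divides the recursive one, so it cannot vanish at [w]
    unless the latter does, in any characteristic. *)
Lemma frac_iter_defined (K : fieldType) (w : {ffun 'I_m -> K}) k :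
  iterate_defined S k -> (frac_iter w k).2 != 0 -> defined_at (iterate S k) w.
Proof.
move=> /iterate_quot[B0 e]; have [_ <-] := zeval_frac_iter w k => b0.
apply/forallP => i; have [Q eB] := den_divides B0 (e i).
by apply: contraNneq b0 => den0; rewrite eB zevalM den0 mul0r.
Qed.

End Iterates.

(** * The system of returns to V *)

Section NormBounds.

Variable m : nat.
Implicit Types F : intpoly m.

Definition l1norm F : nat := \sum_(a <- msupp F) `|mcoeff a F|%N.

Lemma size_msupp F e : (pdeg F <= e)%N -> (size (msupp F) <= e.+1 ^ m)%N.
Proof.
move=> le; pose f (a : multinom m) : {ffun 'I_m -> 'I_e.+1} := [ffun i => inord
  (a i)].
have lei a i : a \in msupp F -> (a i < e.+1)%N.
  move=> /(mdeg_pdeg le); rewrite ltnS; apply: leq_trans.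
  by rewrite mdegE (bigD1 i) //= leq_addr.
have inj : {in msupp F &, injective f}.
  move=> a b aF bF /ffunP eqf; apply/mnmP => i.
  by have := congr1 val (eqf i); rewrite !ffunE /= !inordK ?lei.
have -> : (e.+1 ^ m)%N = #|{ffun 'I_m -> 'I_e.+1}| by rewrite card_ffun
  !card_ord.
rewrite -(size_map f); have /card_uniqP <- : uniq (map f (msupp F)).
  by rewrite map_inj_in_uniq ?msupp_uniq.
exact: max_card.
Qed.

Lemma l1norm_maxcoef F e : (pdeg F <= e)%N -> (l1norm F <= e.+1 ^ m * maxcoef
  F)%N.
Proof.
move=> le; apply: leq_trans (leq_mul (size_msupp le) (leqnn _)).
rewrite /l1norm -sum1_size big_distrl /= [X in (X <= _)%N]big_seq [X in (_ <=
  X)%N]big_seq.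
by apply: leq_sum => a aF; rewrite mul1n /maxcoef (leq_bigmax_seq _ aF).
Qed.

Lemma inorm_hev n e F (u : 'I_m -> ipoly n) v l b :
  (pdeg F <= e)%N -> (l1norm F <= 2 ^ l)%N ->
  (forall i, inorm n (u i) <= 2 ^ b)%N -> (inorm n v <= 2 ^ b)%N ->
  (inorm n (hev e F u v) <= 2 ^ (l + b * e))%N.
Proof.
move=> le lF ub vb; apply: leq_trans (inorm_sum _ _ _) _.
rewrite expnD; apply: leq_trans (leq_mul lF (leqnn _)).
rewrite /l1norm big_distrl /= [X in (X <= _)%N]big_seq [X in (_ <= X)%N]big_seq.
have leX f k : (inorm n f <= 2 ^ b -> inorm n (f ^+ k) <= 2 ^ (b * k))%N.
  move=> fb; apply: leq_trans (inormX _ _) _; rewrite expnM.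
  by case: k => // k; rewrite leq_exp2r.
apply: leq_sum => a /(mdeg_pdeg le) lea.
rewrite -mulrA; apply: leq_trans (inormM _ _) _; rewrite inorm_int leq_mul //.
apply: leq_trans (inormM _ _) _;
  rewrite -[in X in (_ <= X)%N](subnKC lea) mulnDr expnD.
rewrite leq_mul ?leX // mdegE big_distrr expn_sum /=.
by apply: leq_trans (inorm_prod _ _ _) _; apply: leq_prod => i _; apply: leX.
Qed.

Lemma hev1 (K : comNzRingType) e F (u : 'I_m -> K) : hev e F u 1 = zeval F u.
Proof. by rewrite zeval_sum; apply: eq_bigr => a _; rewrite expr1n mulr1. Qed.

(** One step substitutes polynomials of logarithmic norm [c ^ k] into forms of degree [d] and
    multiplies [m] results, which gives at most [m * (l + d * c ^ k) <= c ^ k.+1]. *)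
Lemma inorm_frac_iter (S : 'I_m -> ratfun m) d l k : (0 < m)%N -> (0 < d)%N ->
  (forall i, (rdeg (S i) <= d)%N) ->
  (forall i, (l1norm (num (S i)) <= 2 ^ l)%N) ->
  (forall i, (l1norm (den (S i)) <= 2 ^ l)%N) ->
  let c := (m * (l + d))%N in
  (forall i, (inorm m ((frac_iter S d (@xvar m) k).1 i) <= 2 ^ (c ^ k))%N) /\
  (inorm m (frac_iter S d (@xvar m) k).2 <= 2 ^ (c ^ k))%N.
Proof.
move=> m0 d0 degS lnum lden c; have c0 : (0 < c)%N by rewrite muln_gt0 m0
  addn_gt0 d0 orbT.
elim: k => [|k [IH1 IH2]].
  by split=> [i|]; rewrite /= ?inorm_var // -[1]/(1%:~R) inorm_int.
pose g := (l + c ^ k * d)%N.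
have leg : (g * m <= c ^ k.+1)%N.
  have : (0 < c ^ k)%N by rewrite expn_gt0 c0.
  rewrite /g expnS; move: (c ^ k)%N => ck ck0.
  by rewrite /c -mulnA [(_ * m)%N]mulnC leq_mul2l; apply/orP; right; nia.
have nb i : (inorm m (hev d (num (S i)) (frac_iter S d (@xvar m) k).1
  (frac_iter S d (@xvar m) k).2) <= 2 ^ g)%N.
  by apply: inorm_hev => //; rewrite (leq_trans _ (degS i)) // leq_maxl.
have db i : (inorm m (hev d (den (S i)) (frac_iter S d (@xvar m) k).1
  (frac_iter S d (@xvar m) k).2) <= 2 ^ g)%N.
  by apply: inorm_hev => //; rewrite (leq_trans _ (degS i)) // leq_maxr.
have gm : (\prod_(j < m) 2 ^ g = 2 ^ (g * m))%N by rewrite prod_nat_const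
  card_ord expnM.
rewrite frac_iterS /=; split=> [i|].
  apply: leq_trans (inormM _ _) _; apply: leq_trans (_ : 2 ^ (g * m) <= _)%N;
    last by rewrite leq_exp2l.
  rewrite -gm [X in (_ <= X)%N](bigD1 i) //= leq_mul //.
  by apply: leq_trans (inorm_prod _ _ _) _; apply: leq_prod.
apply: leq_trans (inorm_prod _ _ _) _;
  apply: leq_trans (_ : 2 ^ (g * m) <= _)%N; last by rewrite leq_exp2l.
by rewrite -gm; apply: leq_prod.
Qed.

End NormBounds.

Lemma natr_Fpbar (p n : nat) : prime p -> (n%:R == 0 :> Fpbar p) = (p %| n)%N.
Proof.
move=> pp; rewrite /Fpbar; case: countable_algebraic_closure => K [FtoK /= _].
by rewrite -(rmorph_nat FtoK) fmorph_eq0 -(dvdn_pcharf (pchar_Fp pp)).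
Qed.

Section ReturnSystem.

Variables (m s d D : nat) (S : 'I_m -> ratfun m) (P : 'I_s -> intpoly m) (k :
  nat).
Hypothesis deg_P : forall j, (pdeg (P j) <= D)%N.

(* The first equation inverts the common denominator of the k-th iterate. *)
Definition return_system : seq (ipoly m.+1) :=
  let: (a, b) := frac_iter S d (@xvar m) k in
  ('X * b%:P - 1 : {poly ipoly m}) ::
  [seq ((zeval (P j) (@xvar m))%:P : {poly ipoly m}) | j <- enum 'I_s] ++
  [seq ((hev D (P j) a b)%:P : {poly ipoly m}) | j <- enum 'I_s].

Definition system_point (K : fieldType) (w : {ffun 'I_m -> K}) : seq K :=
  rcons (mkseq (ext w) m) (frac_iter S d w k).2^-1.

Definition first_coords (K : fieldType) (z : seq K) : {ffun 'I_m -> K} :=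
  [ffun i : 'I_m => z`_i].

Lemma first_coordsK (K : fieldType) (w : {ffun 'I_m -> K}) :
  first_coords (system_point w) = w.
Proof.
apply/ffunP => i; rewrite ffunE nth_rcons size_mkseq ltn_ord nth_mkseq //.
by rewrite ext_ord.
Qed.

Lemma common_zero_return_system (K : fieldType) (z : seq K) :
  size z = m.+1 -> let w := first_coords z in
  common_zero return_system z =
  [&& z`_m * (frac_iter S d w k).2 == 1, on_variety P w &
      [forall j, hev D (P j) (frac_iter S d w k).1 (frac_iter S d w k).2 == 0]].
Proof.
move=> sz w; pose g := ieval (nth 0 z) m.
have gw : g \o @xvar m =1 w by move=> i; rewrite /= ieval_var // ffunE.
have [g1 g2] := rmorph_frac_iter S d k gw.
rewrite /common_zero sz eqxx andTb /return_system.
move: g1 g2; case: (frac_iter S d (@xvar m) k) => a b g1 g2.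
have mem_s j : j \in enum 'I_s by rewrite mem_enum.
move: (enum 'I_s) mem_s => e mem_s.
rewrite -cat1s !all_cat all_seq1 !all_map; congr andb; last congr andb.
- rewrite ievalS rmorphB rmorphM rmorph1 /= map_polyX map_polyC.
  by rewrite hornerD hornerN hornerM hornerX !hornerC /= -g2 subr_eq0.
- have Pj j : ieval (nth 0 z) m.+1 (zeval (P j) (@xvar m))%:P = zeval (P j) w.
    by rewrite ievalC (rmorph_zeval g) (eq_zeval _ gw).
  apply/allP/forallP => [h j|h j _]; last by have := h j; rewrite -Pj; apply.
  by rewrite -Pj; exact: (h j (mem_s j)).
- have Pj j : ieval (nth 0 z) m.+1 (hev D (P j) a b)%:P =
    hev D (P j) (frac_iter S d w k).1 (frac_iter S d w k).2.
    by rewrite ievalC (rmorph_hev g) -g2; apply: eq_hev.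
  apply/allP/forallP => [h j|h j _]; last by have := h j; rewrite -Pj; apply.
  by rewrite -Pj; exact: (h j (mem_s j)).
Qed.

Lemma return_system_variety (K : fieldType) (w : {ffun 'I_m -> K}) (v : 'I_m ->
  K) :
  (frac_iter S d w k).2 != 0 ->
  (forall i, v i = (frac_iter S d w k).1 i / (frac_iter S d w k).2) ->
  [forall j, hev D (P j) (frac_iter S d w k).1 (frac_iter S d w k).2 == 0] =
  [forall j, zeval (P j) v == 0].
Proof.
move=> b0 ev; apply: eq_forallb => j; rewrite hevE //.
rewrite mulf_eq0 expf_eq0 (negPf b0) andbF /=; congr (_ == 0).
by apply: eq_zeval => i; rewrite ev.
Qed.

Lemma inorm_return_system l : (0 < m)%N -> (0 < d)%N ->
  (forall i, (rdeg (S i) <= d)%N) ->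
  (forall i, (l1norm (num (S i)) <= 2 ^ l)%N) ->
  (forall i, (l1norm (den (S i)) <= 2 ^ l)%N) ->
  (forall j, (l1norm (P j) <= 2 ^ l)%N) ->
  forall f, f \in return_system ->
  (inorm m.+1 f <= 2 ^ (l + (m * (l + d)) ^ k * D + (m * (l + d)) ^ k + 2))%N.
Proof.
move=> m0 d0 degS lnum lden lP; have := inorm_frac_iter k m0 d0 degS lnum lden.
have c0 : (0 < m * (l + d))%N by rewrite muln_gt0 m0 addn_gt0 d0 orbT.
rewrite /=; have : (0 < (m * (l + d)) ^ k)%N by rewrite expn_gt0 c0.
set c := ((m * (l + d)) ^ k)%N => ck0.
rewrite /return_system; case: frac_iter => a b /= [an bn] f.
rewrite inE mem_cat => /or3P[/eqP ->|/mapP[j _ ->]|/mapP[j _ ->]].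
- apply: leq_trans (inormD _ _) _; rewrite inormN -[1]/(1%:~R) inorm_int.
  rewrite mulrC -['X]expr1 inormMXn inormC.
  apply: leq_trans (_ : 2 ^ c.+1 + 2 ^ c.+1 <= _)%N.
    by rewrite leq_add ?expn_gt0 // expn1 expnSr leq_mul.
  by rewrite addnn -mul2n -expnS leq_exp2l //; lia.
- rewrite inormC -(hev1 D); apply: leq_trans (_ : 2 ^ (l + 1 * D) <= _)%N.
    apply: inorm_hev => // [i|]; first by rewrite inorm_var.
    by rewrite -[1]/(1%:~R) inorm_int.
  by rewrite leq_exp2l //; nia.
rewrite inormC; apply: leq_trans (inorm_hev (b := c) _ _ _ _) _ => //.
by rewrite leq_exp2l //; lia.
Qed.

Lemma size_return_system : size return_system = (s + s).+1.
Proof.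
rewrite /return_system; have := size_enum_ord s; move: (enum 'I_s) => e es.
by case: frac_iter => a b; rewrite /= size_cat !size_map es.
Qed.

End ReturnSystem.

(** [finite_common_zeros] is applied to the return system over [R[i]]. The size of the system is
    exponential in [k] while the elimination exponent [kap] depends on [m] alone, so the bounds
    remain exponential in [k]. *)
Lemma bad_primes (R : realType) (m s d D l : nat) : (0 < m)%N -> (0 < d)%N ->
  exists c, forall (S : 'I_m -> ratfun m) (P : 'I_s -> intpoly m),
    (forall i, (rdeg (S i) <= d)%N) ->
    (forall i, (l1norm (num (S i)) <= 2 ^ l)%N) ->
    (forall i, (l1norm (den (S i)) <= 2 ^ l)%N) ->
    (forall j, (pdeg (P j) <= D)%N) ->
    (forall j, (l1norm (P j) <= 2 ^ l)%N) ->
    generically_escape R S P ->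
  forall k, (0 < k)%N -> exists B, [/\ (0 < B)%N, (B <= 2 ^ (2 ^ (c * k)))%N &
    forall p, prime p -> ~~ (p %| B)%N ->
    exists2 ws : seq {ffun 'I_m -> Fpbar p}, (size ws <= 2 ^ (c * k))%N &
      forall w v, on_variety P w -> orbit_point S w k = Some v ->
        on_variety P v -> w \in ws].
Proof.
move=> m0 d0; have natC_inj : injective (fun n => n%:R : R[i]).
  by move=> i j /eqP; rewrite eqr_nat => /eqP.
have [kap kapP] := finite_common_zeros m.+1 natC_inj.
pose q := (m * (l + d))%N; pose r := (s + s + l + D + 4)%N.
have q0 : (0 < q)%N by rewrite muln_gt0 m0 addn_gt0 d0 orbT.
exists (r * q * kap)%N => S P degS lnum lden degP lP esc k k0.
have [def_k fin] := esc k k0.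
(* One number bounding both the number of equations and their logarithmic norms. *)
pose L := (r * q ^ k)%N.
have qk0 : (0 < q ^ k)%N by rewrite expn_gt0 q0.
have Lk : (L ^ kap <= 2 ^ (r * q * kap * k))%N.
  have -> : (r * q * kap * k = r * q * k * kap)%N by rewrite mulnAC.
  rewrite expnM; case: (kap) => // kp; rewrite leq_exp2r // expnM.
  have : (r * q <= 2 ^ (r * q))%N by rewrite ltnW // ltn_expl.
  move=> le; apply: leq_trans (_ : (r * q) ^ k <= _)%N;
    last by case: (k) k0 => // k' _; rewrite leq_exp2r.
  rewrite /L expnMn leq_mul //; case: (k) k0 => // k' _.
  by rewrite expnS leq_pmulr // expn_gt0 /r addnS.
have r4 : (4 <= r)%N by rewrite /r; lia.
have [||||B [B0 leB BP]] := kapP L (return_system d D S P k).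
- by rewrite /L; nia.
- by rewrite size_return_system /L /r; nia.
- move=> f /(inorm_return_system degP m0 d0 degS lnum lden lP) /leq_trans;
    apply.
  by rewrite leq_exp2l // -/q /L /r; nia.
(* A zero is determined by its first [m] coordinates [w], its last one being the inverse of the
   denominator at [w]. As that denominator is nonzero, the reduced iterate is defined at [w], so [w]
   lies in the finite set of the escape hypothesis. *)
- have /finite_seqP[t /seteqP[tP _]] := fin.
  exists [seq system_point d S k w | w <- t] => z z0.
  have /andP[/eqP sz _] := z0; move: z0.
  rewrite common_zero_return_system //; set w := first_coords m z.
  move=> /and3P[/eqP zb wP vP].
  have b0 : (frac_iter S d w k).2 != 0.
    by apply/eqP => b0; move/eqP: zb; rewrite b0 mulr0 eq_sym oner_eq0.
  have def_w := frac_iter_defined degS def_k b0.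
  have ev := value_iterate degS def_k def_w b0.
  have vP' : on_variety P (value (iterate S k) w).
    by rewrite /on_variety -(return_system_variety degP b0 ev).
  have wt : w \in t by exact: (tP w (And3 wP def_w vP')).
  have -> : z = system_point d S k w; last exact: map_f.
  apply: (@eq_from_nth _ 0); first by rewrite size_rcons size_mkseq.
  move=> i; rewrite sz ltnS leq_eqVlt nth_rcons size_mkseq => /orP[/eqP ->|lti].
    by rewrite ltnn eqxx; apply: (mulIf b0); rewrite zb mulVf.
  by rewrite lti nth_mkseq // -[i in RHS]/(val (Ordinal lti)) ext_ord ffunE.
exists B; split=> //.
  by apply: leq_trans leB _; rewrite leq_exp2l.
move=> p pp npB; have [|zs size_zs zsP] := BP (Fpbar p).
  by rewrite natr_Fpbar.
exists [seq first_coords m z | z <- zs];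
  first by rewrite size_map (leq_trans size_zs).
move=> w v wP wv vP; have [b0 ev] := frac_iter_orbit degS wv.
rewrite -[w](first_coordsK d S k w); apply: map_f; apply: zsP.
have sz : size (system_point d S k w) = m.+1 by rewrite size_rcons size_mkseq.
rewrite common_zero_return_system // first_coordsK.
apply/and3P; split=> //; last by rewrite (return_system_variety degP b0 ev).
by rewrite nth_rcons size_mkseq ltnn eqxx mulVf.
Qed.

(** * Counting visits along an orbit *)

Lemma counting_le_size (R : realType) (T : choiceType) (A : set T) (s : seq T) :
  (forall x, A x -> x \in s) -> (@counting T R A <= (size s)%:R%:E)%E.
Proof.
move=> As; have finA : finite_set A.
  by apply: (sub_finite_set _ (finite_seq s)) => x /As.
rewrite /counting asboolT // lee_fin ler_nat.
apply: uniq_leq_size; first exact: fset_uniq.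
by move=> x; rewrite in_fset_set // inE => /As.
Qed.

Section Orbits.

Variables (R : realType) (m : nat) (K : fieldType) (S : 'I_m -> ratfun m).
Variables (w : {ffun 'I_m -> K}) (N : nat).
Hypothesis size_orbit : (N%:R%:E <= orbit_size R S w)%E.

Let next := obind (@step m K S).
Let start := next (Some w).

Let orbit_pointS n : orbit_point S w n.+1 = iter n next start.
Proof. by rewrite /orbit_point iterSr. Qed.

(** A repetition, that of [None] after a pole included, would confine all points from time 1 on to
    fewer than [N] values. *)
Lemma uniq_orbit : uniq (traject next start N).
Proof.
case: N size_orbit => // n size_n; rewrite looping_uniq;
  apply/negP => /loopingP loop.
suff : (orbit_size R S w <= n%:R%:E)%E.
  by move/(le_trans size_n); rewrite lee_fin ler_nat ltnn.
apply: le_trans (_ : (size (pmap id (traject next start n)))%:R%:E <= _)%E.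
  apply: counting_le_size => v [[//|k] _ kv].
  rewrite mem_pmap map_id; have := loop k; rewrite -orbit_pointS kv.
  by [].
rewrite lee_fin ler_nat size_pmap (leq_trans (count_size _ _)) //.
by rewrite size_traject.
Qed.

Let eq_orbit_pointS i j : (i < N)%N -> (j < N)%N ->
  orbit_point S w i.+1 = orbit_point S w j.+1 -> i = j.
Proof.
move=> lti ltj; rewrite !orbit_pointS => e; apply/eqP.
rewrite -(nth_uniq start _ _ uniq_orbit) ?size_traject //.
by rewrite !nth_traject // e.
Qed.

(** The orbit size counts points from time 1, so an equality at times [i] and [j] is first pushed to
    [i + 1] and [j + 1]. *)
Lemma orbit_point_inj i j : (i < N)%N -> (j < N)%N ->
  orbit_point S w i = orbit_point S w j -> i = j.
Proof.
move=> lti ltj e; apply: eq_orbit_pointS => //.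
by rewrite /orbit_point !iterS -!/(orbit_point S w _) e.
Qed.

(** The value [None] is absorbing, so it would occur at two successive times. *)
Lemma orbit_point_Some n : (n < N)%N -> exists v, orbit_point S w n = Some v.
Proof.
case e : (orbit_point S w n) => [v|]; first by exists v.
case: n e => // n e ltn; have := @eq_orbit_pointS n n.+1 (ltnW ltn) ltn.
have -> : orbit_point S w n.+2 = None.
  by rewrite /orbit_point iterS -/(orbit_point S w n.+1) e.
by move=> /(_ e) /n_Sn.
Qed.

End Orbits.

Lemma card_bigcup_leq (I T : finType) (A : I -> {set T}) :
  (#|(\bigcup_i A i)%SET| <= \sum_i #|A i|)%N.
Proof.
elim/big_rec2: _ => [|i a b _ le]; first by rewrite cards0.
by apply: leq_trans (leq_card_setU _ _) _; rewrite leq_add2l.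
Qed.

(* Elements of V with no other element of V within distance K to their right
   lie in distinct blocks of length K + 1. *)
Lemma card_shift_bound N (V : {set 'I_N}) K T :
  (forall k, (0 < k <= K)%N ->
    #|[set n in V | [exists n' in V, n' == n + k :> nat]]%SET| <= T)%N ->
  (#|V| <= K * T + (N %/ K.+1).+1)%N.
Proof.
move=> shiftT; pose A k := [set n in V | [exists n' in V, n' == (n + k)%N :>
  nat]]%SET.
pose I := [set n in V | [forall k : 'I_K, n \notin A k.+1]]%SET.
have sub : (V \subset (\bigcup_(k < K) A k.+1) :|: I)%SET.
  apply/fintype.subsetP => n nV; rewrite finset.in_setU [n \in I]inE nV /=.
  case: (boolP [forall k : 'I_K, n \notin A k.+1]) => [_|];
    first by rewrite orbT.
  rewrite negb_forall => /existsP[k /negPn nA].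
  by rewrite orbF; apply/bigcupP; exists k.
apply: leq_trans (subset_leq_card sub) _;
  apply: leq_trans (leq_card_setU _ _) _.
apply: leq_add.
  apply: leq_trans (card_bigcup_leq _) _.
  rewrite -[X in (X * T)%N]card_ord -sum_nat_const; apply: leq_sum => k _.
  by apply: shiftT; rewrite /= ltn_ord.
pose f (n : 'I_N) : 'I_(N %/ K.+1).+1 := inord (n %/ K.+1)%N.
have fE n : f n = (n %/ K.+1)%N :> nat.
  by rewrite inordK // ltnS leq_div2r // ltnW.
rewrite -[X in (_ <= X)%N]card_ord -(@card_in_imset _ _ f) ?max_card //.
have near (a b : 'I_N) : a \in I -> b \in I -> f a = f b -> ~ (a < b)%N.
  rewrite inE => /andP[aV /forallP aI]; rewrite inE => /andP[bV _].
  move=> /(congr1 val); rewrite /= !fE => eab ltab.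
  have ltK : (b - a.+1 < K)%N.
    by have := divn_eq a K.+1; have := divn_eq b K.+1;
       have := ltn_pmod b (ltn0Sn K); have := ltn_pmod a (ltn0Sn K);
         rewrite eab; lia.
  have /negP := aI (Ordinal ltK); apply; rewrite inE aV; apply/existsP;
    exists b.
  by rewrite bV /=; apply/eqP; lia.
move=> a b aI bI fab; apply: val_inj => /=.
have := near a b aI bI fab; have := near b a bI aI (esym fab); lia.
Qed.

Section Visits.

Variables (R : realType) (m s d : nat) (K : fieldType).
Variables (S : 'I_m -> ratfun m) (P : 'I_s -> intpoly m).
Variables (w : {ffun 'I_m -> K}) (N : nat).
Hypothesis deg_S : forall i, (rdeg (S i) <= d)%N.
Hypothesis defined_S : forall k, (0 < k)%N -> iterate_defined S k.
Hypothesis size_orbit : (N%:R%:E <= orbit_size R S w)%E.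

(** A visit refers to the reduced [n]-th iterate and the orbit to successive steps; both agree with
    the recursive fraction, whose denominator is nonzero along the orbit. *)
Lemma visits_orbit (n : 'I_N) v : n \in visits S P w N ->
  orbit_point S w n = Some v -> on_variety P v.
Proof.
rewrite inE => /andP[def_n Pn] nv.
have [b0 ev] := frac_iter_orbit deg_S nv.
have it_n : iterate_defined S n by case: (nat_of_ord n) => // k;
  apply: defined_S.
suff <- : value (iterate S n) w = v by [].
by apply/ffunP => i; rewrite (value_iterate deg_S it_n def_n b0) ev.
Qed.

(** The map sending [n] to the orbit point at time [n] is injective on times below [N], and sends
    these visits into [ws]. *)
Lemma card_visits_shift k (ws : seq {ffun 'I_m -> K}) :
  (forall u v, on_variety P u -> orbit_point S u k = Some v ->
    on_variety P v -> u \in ws) ->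
  (#|[set n in visits S P w N | [exists n' in visits S P w N, n' == n + k :>
    nat]]%SET|
     <= size ws)%N.
Proof.
move=> wsP; pose o (n : 'I_N) := odflt w (orbit_point S w n).
have oE (n : 'I_N) : orbit_point S w n = Some (o n).
  by have [v e] := orbit_point_Some size_orbit (ltn_ord n); rewrite /o e.
have o_inj : injective o.
  move=> i j e; apply: val_inj; apply: (orbit_point_inj size_orbit (ltn_ord i)
    (ltn_ord j)).
  by rewrite !oE e.
rewrite cardE -(size_map o); apply: uniq_leq_size.
  by rewrite map_inj_uniq ?enum_uniq.
move=> _ /mapP[n + ->]; rewrite mem_enum inE => /andP[nV /existsP[n' /andP[n'V
  /eqP en']]].
apply: (wsP _ (o n')); [exact: visits_orbit nV (oE n) | | exact: visits_orbit
  n'V (oE n')].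
by rewrite -oE en' /orbit_point -oE addnC iterD.
Qed.

End Visits.

(** * From heights to integer bounds, and the choice of constants *)

Lemma maxcoef_le (R : realType) m (F : intpoly m) (h : R) M :
  expR h <= M%:R -> pheight R F <= h -> (maxcoef F <= M)%N.
Proof.
move=> hM hF; have [->//|F0] := posnP (maxcoef F).
rewrite -(ler_nat R); apply: le_trans hM.
by rewrite -[X in X <= _](@lnK R) ?ler_expR // posrE ltr0n.
Qed.

Lemma l1norm_pow m (F : intpoly m) e M :
  (pdeg F <= e)%N -> (maxcoef F <= M)%N -> (l1norm F <= 2 ^ (e.+1 ^ m * M))%N.
Proof.
move=> le leM; apply: leq_trans (l1norm_maxcoef le) _.
by apply: leq_trans (leq_mul (leqnn _) leM) _; rewrite ltnW // ltn_expl.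
Qed.

Lemma exp2n_le_expR (R : realType) n : (2 ^ n)%:R <= expR n%:R :> R.
Proof.
rewrite -[n%:R]mulr1 expRM_natl natrX lerXn2r ?nnegrE ?expR_ge0 //.
by apply: le_trans (expR_ge1Dx _); rewrite -[2]/(1 + 1).
Qed.

Lemma density_bound (K c : nat) (T : nat) : (0 < K)%N -> (T = 2 ^ (c * K))%N ->
  (K.+1 * (K * T + 1) <= 2 ^ ((c + 2) * K))%N.
Proof.
move=> K0 ->; have leK : (K.+1 <= 2 ^ K)%N by exact: ltn_expl.
have T0 : (0 < 2 ^ (c * K))%N by rewrite expn_gt0.
apply: leq_trans (_ : 2 ^ K * (2 ^ K * 2 ^ (c * K)) <= _)%N.
  apply: leq_mul => //; apply: leq_trans (leq_mul leK (leqnn _)).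
  by rewrite mulSn addnC leq_add2r.
by rewrite -!expnD leq_exp2l //; lia.
Qed.

Theorem theorem5p3 (R : realType) (m s d D : nat) (h H : R)
    (m_ge2 : (2 <= m)%N) (d_ge2 : (2 <= d)%N) :
  exists2 c : R, 0 < c &
  forall (S : 'I_m -> ratfun m) (P : 'I_s -> intpoly m),
    (forall i, (rdeg (S i) <= d)%N) ->
    (forall i, rheight R (S i) <= h) ->
    (forall j, (pdeg (P j) <= D)%N) ->
    (forall j, pheight R (P j) <= H) ->
    generically_escape R S P ->
  forall (eps : R) (N : nat),
    0 < eps -> expR (c / eps) <= N%:R ->
  exists B : nat,
    [/\ (0 < B)%N,
        ln (B%:R : R) <= expR (c / eps) &
        forall p : nat, prime p -> ~~ (p %| B)%N ->
        forall w : {ffun 'I_m -> Fpbar p},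
          (N%:R%:E <= orbit_size R S w)%E ->
          #|visits S P w N|%:R / N%:R <= eps].
Proof.
have m0 : (0 < m)%N by apply: leq_trans m_ge2.
have d0 : (0 < d)%N by apply: leq_trans d_ge2.
pose M := Num.bound (expR h); pose M' := Num.bound (expR H).
have hM : expR h <= M%:R by rewrite ltW // archi_boundP // expR_ge0.
have HM' : expR H <= M'%:R by rewrite ltW // archi_boundP // expR_ge0.
pose l := (d.+1 ^ m * M + D.+1 ^ m * M')%N.
have [c0 c0P] := @bad_primes R m s d D l m0 d0.
(* As [K <= 2 / eps], this choice gives [2 ^ ((c0 + 2) * K) <= expR (c / eps)], the form in which
   all bounds arise. *)
exists (2 * (c0 + 2)%:R); first by rewrite mulr_gt0 // ltr0n addn2.
move=> S P degS hS degP hP esc eps N eps0 leN.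
have N0 : 0 < N%:R :> R by apply: lt_le_trans leN; rewrite expR_gt0.
(* The proportion of visits is at most 1, so no prime has to be excluded when [eps >= 1]. *)
have [eps1|eps1] := lerP 1 eps.
  exists 1%N; rewrite ln1 expR_ge0; split=> // p _ _ w _.
  rewrite ler_pdivrMr //; apply: le_trans (_ : 1 * N%:R <= _);
    last by rewrite ler_pM2r.
  by rewrite mul1r ler_nat -[X in (_ <= X)%N]card_ord max_card.
have ltwice (F : intpoly m) a b : (a <= b)%N -> (l1norm F <= 2 ^ a)%N ->
  (l1norm F <= 2 ^ b)%N.
  by move=> ab /leq_trans; apply; rewrite leq_exp2l.
have lnum i : (l1norm (num (S i)) <= 2 ^ l)%N.
  apply: ltwice (leq_addr _ _) _; apply: l1norm_pow.
    by rewrite (leq_trans _ (degS i)) // leq_maxl.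
  by apply: (maxcoef_le hM); rewrite (le_trans _ (hS i)) // le_max lexx.
have lden i : (l1norm (den (S i)) <= 2 ^ l)%N.
  apply: ltwice (leq_addr _ _) _; apply: l1norm_pow.
    by rewrite (leq_trans _ (degS i)) // leq_maxr.
  by apply: (maxcoef_le hM); rewrite (le_trans _ (hS i)) // le_max lexx orbT.
have lP j : (l1norm (P j) <= 2 ^ l)%N.
  by apply: ltwice (leq_addl _ _) _; apply: l1norm_pow => //;
    apply: maxcoef_le HM' _.
have badP := c0P S P degS lnum lden degP lP esc.
(* [b k] treats returns after [k + 1] steps. *)
have /choice[b bP] := fun k => badP k.+1 isT.
have def_S k : (0 < k)%N -> iterate_defined S k by move=> /esc[].
(* Since [K + 1 > 2 / eps], the visits isolated at distance [K], about one per block of length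
   [K + 1], make up at most [eps / 2] of the times, up to one block. *)
pose K := Num.trunc (2 / eps).
have eps2 : 0 <= 2 / eps by rewrite divr_ge0 // ltW.
have /andP[leK ltK] : (K%:R <= 2 / eps < K.+1%:R) by exact: truncn_itv.
have K0 : (0 < K)%N.
  rewrite lt0n; apply: contraTneq ltK => ->;
    rewrite -leNgt ler_pdivlMr // mul1r.
  by rewrite (le_trans (ltW eps1)) // ler1n.
have expK (a : nat) : (a <= c0 + 2)%N -> (2 ^ (a * K))%:R <= expR (2 * (c0 +
  2)%:R / eps) :> R.
  move=> lea; apply: le_trans (exp2n_le_expR _ _) _; rewrite ler_expR natrM.
  rewrite mulrAC mulrC ler_pM ?ler_nat //.
exists (\prod_(k < K) b k)%N; split.
- by rewrite prodn_gt0 // => k; case: (bP k).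
- have leB : (\prod_(k < K) b k <= 2 ^ (2 ^ ((c0 + 1) * K)))%N.
    apply: leq_trans (_ : \prod_(k < K) 2 ^ (2 ^ (c0 * K)) <= _)%N.
      apply: leq_prod => k _; have [_ le _] := bP k; apply: leq_trans le _.
      by rewrite !leq_exp2l // leq_mul2l ltn_ord orbT.
    rewrite prod_nat_const card_ord -expnM leq_exp2l // mulnDl mul1n expnD
      leq_mul2l.
    by rewrite ltnW ?orbT // ltn_expl.
  apply: le_trans (expK (c0 + 1)%N _); last by rewrite leq_add2l.
  rewrite -ler_expR lnK; last first.
    by rewrite posrE ltr0n prodn_gt0 // => k; case: (bP k).
  by apply: le_trans (exp2n_le_expR _ _); rewrite ler_nat.
move=> p pp npB w size_w; pose T := (2 ^ (c0 * K))%N.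
have le_visits : (#|visits S P w N| <= K * T + (N %/ K.+1).+1)%N.
  apply: card_shift_bound => -[//|k] /= ltkK.
  have [_ _ /(_ p pp)] := bP k.
  case=> [|ws size_ws wsP].
    apply: contra npB => /dvdn_trans; apply.
    by rewrite (bigD1 (Ordinal ltkK)) //= dvdn_mulr.
  apply: leq_trans (card_visits_shift degS def_S size_w wsP) _.
  by apply: leq_trans size_ws _; rewrite leq_exp2l // leq_mul2l ltkK orbT.
rewrite ler_pdivrMr //; apply: le_trans (_ : (K * T + (N %/ K.+1).+1)%:R <= _).
  by rewrite ler_nat.
have dens : (K.+1 * (K * T + 1))%:R <= N%:R :> R.
  by apply: le_trans leN; apply: le_trans (expK _ (leqnn _));
    rewrite ler_nat density_bound.
have divN : (N %/ K.+1 * K.+1)%:R <= N%:R :> R by rewrite ler_nat leq_trunc_div.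
have half : 1 <= K.+1%:R * (eps / 2).
  by rewrite mulrA ler_pdivlMr // mul1r -ler_pdivrMr // ltW.
have e2 : 0 < eps / 2 by rewrite divr_gt0.
(* The lower bound on [N] makes the visits followed by a return within [K] steps, together with the
   incomplete last block, fit into the other half of [eps * N]. *)
have le1 : (K * T + 1)%:R <= (eps / 2) * N%:R.
  apply: le_trans (_ : eps / 2 * (K.+1 * (K * T + 1))%:R <= _);
    last by rewrite ler_pM2l.
  by rewrite natrM mulrA [eps / 2 * _]mulrC ler_peMl.
have le2 : (N %/ K.+1)%:R <= (eps / 2) * N%:R.
  apply: le_trans (_ : eps / 2 * (N %/ K.+1 * K.+1)%:R <= _);
    last by rewrite ler_pM2l.
  by rewrite natrM [_ * K.+1%:R]mulrC mulrA [eps / 2 * _]mulrC ler_peMl.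
rewrite -addn1 addnA addnAC natrD.
by apply: le_trans (lerD le1 le2) _; rewrite -mulrDl -splitr.
Qed.
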